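(* Let $p$ be an initialization-restricted program. Then for every program point $u$, the set of all two-variable Herbrand equalities that are valid whenever $u$ is reached can be effectively determined.
   Context: $\Omega$ is a ranked signature with non-empty set of constants; values are ground terms over $\Omega$. A program consists of a finite set of parameterless procedures (including a main procedure) operating on a finite set $\mathbf{X}$ of global program variables; each procedure is given by a control flow graph with a start and a return point, whose edges are labelled with assignments $\mathbf{x}=t$ where $t$ is a term over $\Omega$ containing occurrences of at most one program variable, non-deterministic assignments $\mathbf{x}=?$ (assigning an arbitrary ground term), or procedure calls $q()$. Program states map variables to ground terms; execution proceeds along inter-procedurally valid paths (calls matched with returns) starting at the start point of main. An equality is valid at $u$ if it holds in every state with which $u$ can be reached. A two-variable Herbrand equality is an equality $s\doteq t$ between terms over $\Omega$ each containing occurrences of at most one program variable (e.g. $\mathbf{x}\doteq f(g(\mathbf{y}),\mathbf{y},a)$). Let $R$ be the set of ground right-hand sides of assignments and $G$ the set of ground subterms of non-ground right-hand sides; the program is initialization-restricted if $R\cap G=\emptyset$ and no element of $R$ is a proper subterm of another element of $R$. *)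

(* Defs.v *)
From Stdlib Require List.
From mathcomp Require Import all_boot.

Set Implicit Arguments.
Unset Strict Implicit.
Unset Printing Implicit Defensive.

(* A computation model: partial recursive functions over binary trees, i.e.
   the analogue over trees of Kleene's mu-recursive functions (structural
   recursion plus unbounded iteration).  The fragment without [RRec] is Jones'
   language WHILE, which is already Turing complete. *)

Inductive btree : Type := Leaf | Node of btree & btree.

Inductive recfun : Type :=
| RId
| RLeaf
| RLeft
| RRight
| RPair of recfun & recfun
| RComp of recfun & recfun
| RIf of recfun & recfun & recfun
| RRec of recfun & recfun
| RWhile of recfun & recfun.

(* [computes f x y]: on input [x], [f] terminates with result [y].  Truth is
   "not a leaf".  [RRec f g] recurses on the second component of its input,
   the first one being a parameter. *)
Inductive computes : recfun -> btree -> btree -> Prop :=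
| computes_id x : computes RId x x
| computes_leaf x : computes RLeaf x Leaf
| computes_left a b : computes RLeft (Node a b) a
| computes_left0 : computes RLeft Leaf Leaf
| computes_right a b : computes RRight (Node a b) b
| computes_right0 : computes RRight Leaf Leaf
| computes_pair f g x a b :
    computes f x a -> computes g x b -> computes (RPair f g) x (Node a b)
| computes_comp f g x y z :
    computes g x y -> computes f y z -> computes (RComp f g) x z
| computes_if_true c f g x a b y :
    computes c x (Node a b) -> computes f x y -> computes (RIf c f g) x y
| computes_if_false c f g x y :
    computes c x Leaf -> computes g x y -> computes (RIf c f g) x y
| computes_rec_leaf f g p y :
    computes f p y -> computes (RRec f g) (Node p Leaf) y
| computes_rec_node f g p a b ya yb y :
    computes (RRec f g) (Node p a) ya ->
    computes (RRec f g) (Node p b) yb ->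
    computes g (Node p (Node (Node a b) (Node ya yb))) y ->
    computes (RRec f g) (Node p (Node a b)) y
| computes_while_stop c f x :
    computes c x Leaf -> computes (RWhile c f) x x
| computes_while_step c f x a b y z :
    computes c x (Node a b) -> computes f x y ->
    computes (RWhile c f) y z -> computes (RWhile c f) x z.

Lemma computes_fun f x y z : computes f x y -> computes f x z -> y = z.
Proof.
move=> H; elim: H z => {f x y}; intros;
  match goal with H : computes _ _ ?z |- _ = ?z => inversion H; subst end;
  repeat match goal with
  | IH : forall z, computes ?f ?x z -> _ = z, K : computes ?f ?x _ |- _ =>
      move: (IH _ K) => {}K; try discriminate K; subst
  end; by [].
Qed.

Section Programs.

(* A ranked signature is a type [F] of symbols with ranks [ar].  [F] is a
   countType, finite or not, since symbols must be coded to be given as input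
   to an algorithm. *)
Variables (F : countType) (ar : F -> nat).

Inductive term : Type := Var of nat | App of F & seq term.

Fixpoint vars (t : term) : seq nat :=
  match t with
  | Var x => [:: x]
  | App _ ts => flatten (map vars ts)
  end.

Fixpoint ranked (t : term) : bool :=
  match t with
  | Var _ => true
  | App f ts => (size ts == ar f) && all ranked ts
  end.

Fixpoint subst (s : nat -> term) (t : term) : term :=
  match t with
  | Var x => s x
  | App f ts => App f (map (subst s) ts)
  end.

Inductive subterm (s : term) : term -> Prop :=
| subterm_refl : subterm s s
| subterm_arg f ts t : List.In t ts -> subterm s t -> subterm s (App f ts).

Definition ground (t : term) : bool := nilp (vars t).

Definition value (t : term) : bool := ranked t && ground t.

(* A term over the signature and the program variables 0, ..., n-1. *)
Definition wf_term (n : nat) (t : term) : bool :=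
  ranked t && all (fun x => x < n) (vars t).

Definition at_most_one_var (t : term) : bool := size (undup (vars t)) <= 1.

Inductive label : Type :=
| Assign of nat & term
| Havoc of nat            (* the non-deterministic assignment x = ? *)
| Call of nat.

(* The points of a procedure are 0, ..., npoints-1. *)
Record procedure : Type := Procedure {
  npoints : nat;
  start : nat;
  ret : nat;
  edges : seq (nat * label * nat)
}.

Record program : Type := Program {
  nvars : nat;
  procs : seq procedure;
  main : nat
}.

Definition wf_label (p : program) (l : label) : bool :=
  match l with
  | Assign x t => [&& x < nvars p, wf_term (nvars p) t & at_most_one_var t]
  | Havoc x => x < nvars p
  | Call q => q < size (procs p)
  end.

Definition wf_procedure (p : program) (pr : procedure) : bool :=
  [&& start pr < npoints pr,
      ret pr < npoints pr
    & all (fun e : nat * label * nat =>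
             [&& e.1.1 < npoints pr, wf_label p e.1.2 & e.2 < npoints pr])
          (edges pr)].

Definition wf_program (p : program) : bool :=
  (main p < size (procs p)) && all (wf_procedure p) (procs p).

(* A program point is a procedure together with a point of its graph. *)
Definition point : Type := (nat * nat)%type.

Definition is_point (p : program) (u : point) : bool :=
  if onth (procs p) u.1 is Some pr then u.2 < npoints pr else false.

Definition edge (p : program) (u : point) (l : label) (v : nat) : Prop :=
  exists2 pr, onth (procs p) u.1 = Some pr & List.In (u.2, l, v) (edges pr).

Definition is_rhs (p : program) (t : term) : Prop :=
  exists u x v, edge p u (Assign x t) v.

Definition in_R (p : program) (t : term) : Prop := is_rhs p t /\ ground t.

Definition in_G (p : program) (t : term) : Prop :=
  ground t /\ exists t', [/\ is_rhs p t', ~~ ground t' & subterm t t'].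

Definition init_restricted (p : program) : Prop :=
  (forall t, ~ (in_R p t /\ in_G p t)) /\
  (forall s t, in_R p s -> in_R p t -> ~ (subterm s t /\ s <> t)).

(* Only the values of the variables 0, ..., n-1 are relevant. *)
Definition state : Type := nat -> term.

Definition is_state (n : nat) (s : state) : Prop :=
  forall x, x < n -> value (s x).

Definition upd (s : state) (x : nat) (v : term) : state :=
  fun y => if y == x then v else s y.

(* [reaches p st u s]: some execution of [p] starting at the start point of
   [main p] with arbitrary initial values of the variables is at point [u] in
   state [s]; [st] is the stack of return addresses of the pending calls. *)
Inductive reaches (p : program) : seq point -> point -> state -> Prop :=
| reaches_start pr s :
    onth (procs p) (main p) = Some pr -> is_state (nvars p) s ->
    reaches p [::] (main p, start pr) s
| reaches_assign st q u s x t v :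
    reaches p st (q, u) s -> edge p (q, u) (Assign x t) v ->
    reaches p st (q, v) (upd s x (subst s t))
| reaches_havoc st q u s x c v :
    reaches p st (q, u) s -> edge p (q, u) (Havoc x) v -> value c ->
    reaches p st (q, v) (upd s x c)
| reaches_call st q u s r pr v :
    reaches p st (q, u) s -> edge p (q, u) (Call r) v ->
    onth (procs p) r = Some pr ->
    reaches p ((q, v) :: st) (r, start pr) s
| reaches_return st q v s r pr :
    reaches p ((q, v) :: st) (r, ret pr) s ->
    onth (procs p) r = Some pr ->
    reaches p st (q, v) s.

Definition equality : Type := (term * term)%type.

Definition two_var_equality (n : nat) (e : equality) : bool :=
  [&& wf_term n e.1, at_most_one_var e.1, wf_term n e.2 & at_most_one_var e.2].

Definition holds (s : state) (e : equality) : Prop :=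
  subst s e.1 = subst s e.2.

Definition valid_at (p : program) (u : point) (e : equality) : Prop :=
  forall st s, reaches p st u s -> holds s e.

Definition entails (n : nat) (E : seq equality) (e : equality) : Prop :=
  forall s, is_state n s -> (forall e', List.In e' E -> holds s e') ->
  holds s e.

(* Codes of inputs and outputs as binary trees; numbers are in unary. *)

Definition code_bool (b : bool) : btree := if b then Node Leaf Leaf else Leaf.

Definition code_nat (n : nat) : btree := iter n (Node Leaf) Leaf.

Definition code_seq (T : Type) (code : T -> btree) (s : seq T) : btree :=
  foldr (fun x => Node (code x)) Leaf s.

Definition code_tagged (tag : nat) (d : btree) : btree :=
  Node (code_nat tag) d.

Fixpoint code_term (t : term) : btree :=
  match t with
  | Var x => code_tagged 0 (code_nat x)
  | App f ts =>
      code_tagged 1 (Node (code_nat (pickle f)) (code_seq code_term ts))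
  end.

Definition code_label (l : label) : btree :=
  match l with
  | Assign x t => code_tagged 0 (Node (code_nat x) (code_term t))
  | Havoc x => code_tagged 1 (code_nat x)
  | Call q => code_tagged 2 (code_nat q)
  end.

Definition code_edge (e : nat * label * nat) : btree :=
  Node (code_nat e.1.1) (Node (code_label e.1.2) (code_nat e.2)).

Definition code_procedure (pr : procedure) : btree :=
  Node (code_nat (npoints pr))
    (Node (code_nat (start pr))
       (Node (code_nat (ret pr)) (code_seq code_edge (edges pr)))).

Definition code_program (p : program) : btree :=
  Node (code_nat (nvars p))
    (Node (code_seq code_procedure (procs p)) (code_nat (main p))).

Definition code_point (u : point) : btree :=
  Node (code_nat u.1) (code_nat u.2).

Definition code_equality (e : equality) : btree :=
  Node (code_term e.1) (code_term e.2).

(* An infinite set of valid equalities is determined effectively by computing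
   a finite basis of it: finitely many two-variable equalities whose
   two-variable consequences are exactly the valid ones. *)
Definition is_basis (p : program) (u : point) (E : seq equality) : Prop :=
  all (two_var_equality (nvars p)) E /\
  forall e, two_var_equality (nvars p) e ->
    (valid_at p u e <-> entails (nvars p) E e).

Definition computes_basis (f : recfun) (p : program) (u : point) : Prop :=
  exists2 E : seq equality,
    computes f (Node (code_program p) (code_point u)) (code_seq code_equality E)
    & is_basis p u E.

Definition decides_validity (f : recfun) (p : program) (u : point) : Prop :=
  forall e, two_var_equality (nvars p) e ->
    exists2 b : bool,
      computes f (Node (code_program p) (Node (code_point u) (code_equality e)))
        (code_bool b)
      & (valid_at p u e <-> b).

End Programs.

(* Main.v *)
From HB Require Import structures.
From Stdlib Require Import Classical_Prop.
Require Import Defs.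
From mathcomp Require Import all_boot all_algebra zify.

Set Implicit Arguments.
Unset Strict Implicit.
Unset Printing Implicit Defensive.

(** Under initialization-restriction the elements of R can be treated as fresh
variables, so every value is a term with exactly one variable; such terms form a
free monoid under plugging.  Reading a value as the polynomial whose
coefficients are the letters of its word turns each assignment into an affine
map over Q(X), and an equality [x = t], where [t] has one variable, into an
affine relation.  As in the interprocedural analysis of affine relations, the
matrices of the executions of a procedure span a space of bounded dimension, so
a relation is valid as soon as it holds after the executions whose derivation
has depth at most an explicit bound [N].  An equality [x = t] in which [t] has
both a program variable and an initial value can only hold for finitely many
values of [x]; indicator functions of these values then play the role of the
polynomials.  Every two-variable equality decomposes into such equalities
[x = t].  Hence validity is decided by executing the program up to derivation
depth [N], and a basis is found among the finitely many equalities [x = t[y]]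
that hold in one reachable state.  Havocs need to draw only from two generic
values, as two distinct values separate any two distinct one-variable terms. *)

(** * Terms *)

(** The algebra occurs in the correctness proof only: the algorithm enumerates derivations and
    compares terms, while the spans show how many rounds suffice. Affinity of assignments rests on
    both halves of initialization-restriction. Disjointness of R and G leaves non-ground right-hand
    sides untouched when the elements of R are replaced by variables; the subterm condition keeps an
    element of R from being assembled around another one during a run. So the replacement commutes
    with execution. The obstacle is the equality itself, which is unrestricted: it may contain an
    element of R next to a program variable, and then plugging into it is no longer an operation on
    one-variable terms. Hence the second family of linear features. Its size grows with the depth of
    the equality, so [N] depends on the equality, and no single depth is available for all of them.
    A basis therefore tests each of its candidates with a bound of its own. The base of the
    polynomials is an indeterminate, so letters can be coded by unbounded digits without carries;
    fractions provide a field for the dimension argument. *)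

Section TermCountable.
Variable F : countType.

Fixpoint term_tree (t : term F) : GenTree.tree (nat + F) :=
  match t with
  | Var x => GenTree.Leaf (inl x)
  | App f ts => GenTree.Node 0 (GenTree.Leaf (inr f) :: map term_tree ts)
  end.

Fixpoint tree_term (g : GenTree.tree (nat + F)) : term F :=
  match g with
  | GenTree.Leaf (inl x) => Var F x
  | GenTree.Node _ (GenTree.Leaf (inr f) :: gs) => App f (map tree_term gs)
  | _ => Var F 0
  end.

(** The generated principle has no hypothesis for arguments inside the nested list. [List.In] is
    used because terms get their decidable equality only from [term_treeK]; [term_indS] restates the
    principle with boolean membership. *)
Lemma term_ind_in (P : term F -> Prop) :
  (forall x, P (Var F x)) ->
  (forall f ts, (forall t, List.In t ts -> P t) -> P (App f ts)) ->
  forall t, P t.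
Proof.
move=> PV PA; fix IH 1 => -[x|f ts]; first exact: PV.
apply: PA; elim: ts => [s []|t ts IHts s [<-|]]; first exact: IH.
exact: IHts.
Qed.

Lemma term_treeK : cancel term_tree tree_term.
Proof.
elim/term_ind_in => [x|f ts IH] //=; congr App.
by elim: ts IH => //= t ts IHts IH; rewrite IH ?IHts//; [move=> s st; apply: IH; right|left].
Qed.

HB.instance Definition _ := Countable.copy (term F) (can_type term_treeK).

Lemma InP (T : eqType) (x : T) s : reflect (List.In x s) (x \in s).
Proof.
elim: s => [|y s IH] /=; first by apply: ReflectF.
rewrite inE eq_sym; apply: (iffP orP) => [[/eqP->|/IH]|[->|/IH]]; auto.
Qed.

Lemma term_indS (P : term F -> Prop) :
  (forall x, P (Var F x)) ->
  (forall f ts, {in ts, forall t, P t} -> P (App f ts)) ->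
  forall t, P t.
Proof.
move=> PV PA; elim/term_ind_in => // f ts IH.
by apply: PA => t /InP; apply: IH.
Qed.
End TermCountable.

Section Terms.
Variable F : countType.
Implicit Types (s t u v : term F) (r : nat -> term F) (x y z : nat).

Lemma Var_eq x y : (Var F x == Var F y) = (x == y).
Proof. by apply/eqP/eqP => [[]|->]. Qed.

Lemma vars_App f (ts : seq (term F)) z :
  reflect (exists2 t, t \in ts & z \in vars t) (z \in vars (App f ts)).
Proof. by apply: (iffP flatten_mapP). Qed.

Lemma in_vars_App f (ts : seq (term F)) t z :
  t \in ts -> z \in vars t -> z \in vars (App f ts).
Proof. by move=> ? ?; apply/vars_App; exists t. Qed.

Lemma eq_subst_in r1 r2 t : {in vars t, r1 =1 r2} -> subst r1 t = subst r2 t.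
Proof.
elim/term_indS: t => [x|f ts IH] E /=; first by apply: E; rewrite inE.
congr App; apply/eq_in_map => t tin; apply: IH => // z zt.
by apply: E; apply: in_vars_App tin zt.
Qed.

Lemma eq_subst r1 r2 t : r1 =1 r2 -> subst r1 t = subst r2 t.
Proof. by move=> E; apply: eq_subst_in => z _. Qed.

Lemma subst_comp r1 r2 t :
  subst r1 (subst r2 t) = subst (fun x => subst r1 (r2 x)) t.
Proof.
elim/term_indS: t => [x|f ts IH] //=; congr App.
by rewrite -map_comp; apply/eq_in_map => t /IH.
Qed.

Lemma subst_Var_in r t : {in vars t, r =1 @Var F} -> subst r t = t.
Proof.
elim/term_indS: t => [x|f ts IH] E /=; first by rewrite E ?inE.
congr App; rewrite -[RHS]map_id; apply/eq_in_map => t tin.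
by apply: IH => // z zt; apply: E; apply: in_vars_App tin zt.
Qed.

Lemma subst_Var t : subst (@Var F) t = t.
Proof. exact: subst_Var_in. Qed.

Lemma vars_subst r t z :
  reflect (exists2 y, y \in vars t & z \in vars (r y)) (z \in vars (subst r t)).
Proof.
suff E : z \in vars (subst r t) <-> exists2 y, y \in vars t & z \in vars (r y).
  by apply: (iffP idP) => /E.
elim/term_indS: t => [x|f ts IH].
  split=> [h|[y]]; first by exists x; rewrite ?inE.
  by rewrite inE => /eqP->.
split=> [/vars_App[_ /mapP[t tin ->] /(IH _ tin)[y yt zy]]|].
  by exists y => //; apply: in_vars_App tin yt.
case=> y /vars_App[t tin yt] zy; apply/vars_App.
by exists (subst r t); [exact: map_f | apply/(IH _ tin); exists y].
Qed.

Lemma groundP t : reflect (forall z, z \notin vars t) (ground t).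
Proof.
rewrite /ground; case: (vars t) => [|z s] /=; first by apply: ReflectT.
by apply: ReflectF => /(_ z); rewrite inE eqxx.
Qed.

Lemma groundPn t : reflect (exists z, z \in vars t) (~~ ground t).
Proof.
rewrite /ground; case: (vars t) => [|z s] /=.
  by apply: ReflectF => -[z].
by apply: ReflectT; exists z; rewrite inE eqxx.
Qed.

Lemma subst_ground r t : ground t -> subst r t = t.
Proof. by move/groundP=> g; apply: subst_Var_in => z; rewrite (negPf (g z)). Qed.

Lemma ground_App f (ts : seq (term F)) : ground (App f ts) = all (@ground F) ts.
Proof.
apply/idP/allP => [/groundP g t tin|g].
  by apply/groundP => z; apply: contra (g z) => ?; apply: in_vars_App tin _.
by apply/groundP => z; apply/negP => /vars_App[t /g/groundP/(_ z)/negP].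
Qed.

Lemma ranked_subst ar r t : ranked ar t -> {in vars t, forall x, ranked ar (r x)} ->
  ranked ar (subst r t).
Proof.
elim/term_indS: t => [x|f ts IH] /=; first by move=> _; apply; rewrite inE.
move=> /andP[sz /allP rk] rr; rewrite size_map sz /= all_map; apply/allP => t tin /=.
by apply: IH => //; [exact: rk|move=> z zt; apply: rr; exact: in_vars_App tin zt].
Qed.

Lemma value_subst ar n r t : wf_term ar n t -> is_state ar n r -> value ar (subst r t).
Proof.
move=> /andP[rt /allP vt] rn; apply/andP; split.
  by apply: ranked_subst => // x /vt/rn/andP[].
apply/groundP => z; apply/vars_subst => -[y /vt/rn/andP[_ /groundP/(_ z)/negP]].
by [].
Qed.

Fixpoint tsz t : nat := match t with Var _ => 1 | App _ ts => (sumn (map tsz ts)).+1 end.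

Lemma tsz_arg f (ts : seq (term F)) t : t \in ts -> tsz t < tsz (App f ts).
Proof.
rewrite /= ltnS; elim: ts => //= s ts IH; rewrite inE => /orP[/eqP->|/IH h].
  exact: leq_addr.
exact: leq_trans h (leq_addl _ _).
Qed.

Lemma tsz_subst r t z : z \in vars t -> tsz (r z) <= tsz (subst r t).
Proof.
elim/term_indS: t => [x|f ts IH]; first by rewrite inE => /eqP->.
case/vars_App=> t tin zt; apply: leq_trans (IH _ tin zt) _.
by apply: ltnW; apply: tsz_arg; apply: map_f.
Qed.

Lemma tsz_subst_lt r f (ts : seq (term F)) z :
  z \in vars (App f ts) -> tsz (r z) < tsz (subst r (App f ts)).
Proof.
case/vars_App=> t tin zt; apply: leq_ltn_trans (tsz_subst r zt) _.
by apply: tsz_arg; apply: map_f.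
Qed.

Lemma map_inj_in_eq (T1 T2 : eqType) (f g : T1 -> T2) (s1 s2 : seq T1) :
  map f s1 = map g s2 ->
  (forall a b, a \in s1 -> b \in s2 -> f a = g b -> a = b) -> s1 = s2.
Proof.
elim: s1 s2 => [|a s1 IH] [|b s2] //= [e1 e2] H; congr cons.
  by apply: H e1; rewrite inE eqxx.
by apply: IH e2 _ => c d ? ?; apply: H; rewrite inE ?orbT //; apply/orP; right.
Qed.

(** When a variable faces an application, a ground application forces [v1 = v2], and the instance of
    a non-ground one is strictly larger than the value plugged in. *)
Lemma subst_inj_x x v1 v2 (s t : term F) :
  {subset vars s <= [:: x]} -> {subset vars t <= [:: x]} -> v1 <> v2 ->
  (forall c, c = v1 \/ c = v2 -> subst (fun _ => c) s = subst (fun _ => c) t) ->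
  s = t.
Proof.
move=> + + n12; elim/term_indS: s t => [y|f ts IH] [z|g us] sx tx E.
- by have := sx y; have := tx z; rewrite !inE !eqxx => /(_ isT)/eqP-> /(_ isT)/eqP->.
- have [/groundP gr|/groundPn[w wi]] := boolP (ground (App g us)).
    case: n12; rewrite -[v1]/(subst (fun _ => v1) (Var F y)) -[v2]/(subst (fun _ => v2) (Var F y)).
    by rewrite !E ?(@eq_subst_in (fun=> v1) (fun=> v2)); auto => c; rewrite (negPf (gr c)).
  by have := tsz_subst_lt (fun=> v1) wi; rewrite -E ?ltnn; auto.
- have [/groundP gr|/groundPn[w wi]] := boolP (ground (App f ts)).
    case: n12; rewrite -[v1]/(subst (fun _ => v1) (Var F z)) -[v2]/(subst (fun _ => v2) (Var F z)).
    by rewrite -!E ?(@eq_subst_in (fun=> v1) (fun=> v2)); auto => c; rewrite (negPf (gr c)).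
  by have := tsz_subst_lt (fun=> v1) wi; rewrite E ?ltnn; auto.
have [-> _] : f = g /\ True by have [] := E v1 (or_introl erefl).
congr App.
have [_ E1] := E v1 (or_introl erefl); have [_ E2] := E v2 (or_intror erefl).
elim: ts us E1 E2 IH sx tx {E} => [|s ts IHts] [|t us] //= [e1 E1] [e2 E2] IH sx tx.
congr cons.
  apply: IH => //; first by rewrite inE eqxx.
  - by move=> w wi; apply: sx; rewrite /= mem_cat wi.
  - by move=> w wi; apply: tx; rewrite /= mem_cat wi.
  - by move=> c [->|->].
apply: IHts => //.
- by move=> r ri; apply: IH; rewrite inE ri orbT.
- by move=> w wi; apply: sx; rewrite /= mem_cat -[_ \in flatten _]/(w \in vars (App f ts)) wi orbT.
- by move=> w wi; apply: tx; rewrite /= mem_cat -[_ \in flatten _]/(w \in vars (App f us)) wi orbT.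
Qed.

Lemma at_most_one_varP t :
  reflect (exists x, {subset vars t <= [:: x]}) (at_most_one_var t).
Proof.
apply: (iffP idP) => [|[x sx]].
  rewrite /at_most_one_var; case E: (undup _) => [|x [|//]] _.
    by exists 0 => z; rewrite -mem_undup E.
  by exists x => z; rewrite -mem_undup E.
rewrite /at_most_one_var -[1]/(size [:: x]); apply: uniq_leq_size (undup_uniq _) _.
by move=> z; rewrite mem_undup; apply: sx.
Qed.

Lemma subst1v t x c r : {subset vars t <= [:: x]} -> r x = c ->
  subst r t = subst (fun _ => c) t.
Proof. by move=> sx rx; apply: eq_subst_in => z /sx; rewrite inE => /eqP->. Qed.

(* Two distinct values are as good as infinitely many generic ones. *)
Lemma two_values s t v1 v2 :
  at_most_one_var s -> at_most_one_var t -> v1 <> v2 ->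
  (forall r, (forall x, r x = v1 \/ r x = v2) -> subst r s = subst r t) -> s = t.
Proof.
move=> /at_most_one_varP[x sx] /at_most_one_varP[y ty] n12 E.
have [exy|nxy] := eqVneq x y.
  apply: (@subst_inj_x x v1 v2) => //; first by rewrite exy.
  by move=> c cv; apply: E => _.
(* For different variables the two sides vary independently, so each of them is constant in its own
   variable and hence ground. *)
have E2 a b : (a = v1 \/ a = v2) -> (b = v1 \/ b = v2) ->
    subst (fun _ => a) s = subst (fun _ => b) t.
  move=> av bv; have /= := E (fun z => if z == x then a else b).
  rewrite (@subst1v s x a) ?eqxx// (@subst1v t y b) ?[y == x]eq_sym ?(negPf nxy)//.
  by apply=> z; case: ifP.
have gr : forall u w, {subset vars u <= [:: w]} -> subst (fun _ => v1) u = subst (fun _ => v2) u ->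
    ground u.
  elim/term_indS => [z|f ts IH] w uw //= [] E3; rewrite ground_App.
  apply/allP => u ui; apply: (IH u ui w).
    by move=> z zu; apply: uw; apply: in_vars_App ui zu.
  by move/eq_in_map: E3; apply.
have gs : ground s by apply: (gr _ x sx); rewrite (E2 _ v1) ?(E2 v2 v1); auto.
have gt : ground t by apply: (gr _ y ty); rewrite -(E2 v1) -?(E2 v1 v2); auto.
by have := E (fun _ => v1); rewrite !subst_ground //; apply; auto.
Qed.

End Terms.

(** * Executions as words of assignments *)

Section LabelCountable.
Variable F : countType.

Definition label_sum (l : label F) : (nat * term F) + (nat + nat) :=
  match l with Assign x t => inl (x, t) | Havoc x => inr (inl x) | Call r => inr (inr r) end.

Definition sum_label (l : (nat * term F) + (nat + nat)) : label F :=
  match l with inl xt => Assign xt.1 xt.2 | inr (inl x) => Havoc F x | inr (inr r) => Call F r end.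

Lemma label_sumK : cancel label_sum sum_label. Proof. by case. Qed.

HB.instance Definition _ := Countable.copy (label F) (can_type label_sumK).
End LabelCountable.

Section Language.
Variables (F : countType) (ar : F -> nat).

Definition letter : Type := (nat * term F)%type.
Definition word : Type := seq letter.
Definition node : Type := (bool * (nat * nat))%type.
Definition item : Type := (node * word)%type.

Definition exec (a : letter) (r : state F) : state F := upd r a.1 (subst r a.2).
Definition run (w : word) (r : state F) : state F := foldl (fun r a => exec a r) r w.

Definition subst1 (a : letter) (t : term F) : term F := subst (upd (@Var F) a.1 a.2) t.
(** The weakest precondition transformer: by [subst_run] an equality holds after [w] exactly if its
    image under [wp w] holds before. *)
Definition wp (w : word) (t : term F) : term F := foldr subst1 t w.

Lemma run_cat w1 w2 r : run (w1 ++ w2) r = run w2 (run w1 r).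
Proof. exact: foldl_cat. Qed.

Lemma run_rcons w a r : run (rcons w a) r = exec a (run w r).
Proof. by rewrite -cats1 run_cat. Qed.

Lemma subst_exec a r t : subst (exec a r) t = subst r (subst1 a t).
Proof.
by rewrite subst_comp; apply: eq_subst => z; rewrite /exec /upd; case: eqP.
Qed.

Lemma subst_run w r t : subst (run w r) t = subst r (wp w t).
Proof. by elim: w r => //= a w IH r; rewrite IH subst_exec. Qed.

Lemma run_out n w r z : all (fun a : letter => a.1 < n) w -> n <= z -> run w r z = r z.
Proof.
move=> aw nz; elim: w r aw => //= a w IH r /andP[an aw].
by rewrite IH // /exec /upd gtn_eqF // (leq_trans an nz).
Qed.

Variable p : program F.
Let n := nvars p.

Definition getp q : procedure F := nth (Procedure 0 0 0 [::]) (procs p) q.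

Lemma onth_getp q pr : onth (procs p) q = Some pr -> getp q = pr.
Proof. exact: onth_nth. Qed.

(* [derives H true u w] when [w] is executed on the way from the start of main
   to [u], and [derives H false u w] when [w] is executed on a same-level path
   from the start of the procedure of [u].  The program variables are
   [0 .. n-1]; the never assigned variable [n + k] is the source of the values
   drawn by havocs, [H] delimits the admissible [k]. *)
Inductive derives (H : pred nat) : bool -> point -> word -> Prop :=
| derives_main pr : onth (procs p) (main p) = Some pr ->
    derives H true (main p, start pr) [::]
| derives_start q pr : onth (procs p) q = Some pr -> derives H false (q, start pr) [::]
| derives_assign b q u w x t v : derives H b (q, u) w -> edge p (q, u) (Assign x t) v ->
    derives H b (q, v) (rcons w (x, t))
| derives_havoc b q u w x k v : derives H b (q, u) w -> edge p (q, u) (Havoc F x) v -> H k ->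
    derives H b (q, v) (rcons w (x, Var F (n + k)))
| derives_enter q u w r pr v : derives H true (q, u) w -> edge p (q, u) (Call F r) v ->
    onth (procs p) r = Some pr -> derives H true (r, start pr) w
| derives_call b q u w r pr v w2 : derives H b (q, u) w -> edge p (q, u) (Call F r) v ->
    onth (procs p) r = Some pr -> derives H false (r, ret pr) w2 ->
    derives H b (q, v) (w ++ w2).

Hypothesis wfp : wf_program ar p.

Lemma onth_some q : q < size (procs p) -> onth (procs p) q = Some (getp q).
Proof. by move=> h; rewrite onthE (nth_map (Procedure 0 0 0 [::])). Qed.

Lemma onth_lt q pr : onth (procs p) q = Some pr -> q < size (procs p).
Proof. by move=> e; rewrite -onthTE e. Qed.

Lemma wf_proc q : q < size (procs p) -> wf_procedure ar p (getp q).
Proof.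
by move=> h; case/andP: wfp => _ /all_nthP; apply.
Qed.

Lemma wf_edge u l v : edge p u l v -> [/\ u.1 < size (procs p), u.2 < npoints (getp u.1),
  wf_label ar p l, v < npoints (getp u.1) & (u.2, l, v) \in edges (getp u.1)].
Proof.
case=> pr e /InP ei; have h := onth_lt e; rewrite -(onth_getp e) in ei.
by have /and3P[_ _ /allP/(_ _ ei)/and3P[]] := wf_proc h.
Qed.

Definition wf_letter (a : letter) : bool := a.1 < n.

Lemma derives_wf H b u w : derives H b u w -> all wf_letter w.
Proof.
elim=> //= {b u w} [b q u w x t v _ IH /wf_edge[_ _ /and3P[? _ _] _ _]|
  b q u w x k v _ IH /wf_edge[_ _ ? _ _] _|b q u w r pr v w2 _ IH _ _ _ IH2].
- by rewrite all_rcons IH andbT.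
- by rewrite all_rcons IH andbT.
- by rewrite all_cat IH.
Qed.

Lemma reaches_is_state st u s : reaches ar p st u s -> is_state ar n s.
Proof.
elim=> // {st u s} [st q u s x t v _ IH /wf_edge[_ _ /and3P[? wt _] _ _]|
  st q u s x c v _ IH _ vc] z zn; rewrite /upd; case: eqP => _; auto.
exact: value_subst wt IH.
Qed.

(** The invariant behind [reaches_derives]. [derives H true] forgets return addresses, so the word
    is split at every pending call into a part leading to the call site and a same-level part of the
    callee; these are the premises of [derives_call] at the matching return. *)
Fixpoint stacked H (st : seq point) (u : point) (w : word) : Prop :=
  exists w1 w2, [/\ w = w1 ++ w2, derives H false u w2 &
    match st with
    | [::] => w1 = [::] /\ u.1 = main p
    | (q, v) :: st => exists u', [/\ edge p (q, u') (Call F u.1) v, derives H true (q, u') w1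
        & stacked H st (q, u') w1]
    end].

Lemma stacked_cat H st q u u' w a :
  stacked H st (q, u) w ->
  (forall w2, derives H false (q, u) w2 -> derives H false (q, u') (w2 ++ a)) ->
  stacked H st (q, u') (w ++ a).
Proof.
case: st => [|[q' v'] st] /= [w1 [w2 [-> d h]]] D;
  by exists w1, (w2 ++ a); rewrite catA; split=> //; apply: D.
Qed.

(** Surjectivity of [nu] provides a source for every value that a havoc may draw, so a single state
    [r] accounts for the initial values and all draws. *)
Lemma reaches_derives (nu : nat -> term F) st u s :
  (forall c, exists k, nu k = c) -> reaches ar p st u s ->
  exists r w, [/\ stacked predT st u w, derives predT true u w,
    (forall k, r (n + k) = nu k) & forall z, z < n -> s z = run w r z].
Proof.
move=> nuS; elim=> {st u s}.
- move=> pr s e _; exists (fun z => if z < n then s z else nu (z - n)), [::]; split=> /=.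
  + exists [::], [::]; split=> //; exact: derives_start.
  + exact: derives_main.
  + by move=> k; rewrite ltnNge leq_addr /= addKn.
  + by move=> z ->.
- move=> st q u s x t v _ [r [w [sw dw hr hs]]] e; exists r, (rcons w (x, t)).
  split=> //; last 2 [by exact: derives_assign dw e].
  + by rewrite -cats1; apply: stacked_cat sw _ => w2 d; rewrite cats1; exact: derives_assign d e.
  + move=> z zn; rewrite run_rcons /exec /upd; case: eqP => _ /=; last exact: hs.
    have [_ _ /and3P[_ /andP[_ /allP vt] _] _ _] := wf_edge e.
    by apply: eq_subst_in => y /vt; apply: hs.
- move=> st q u s x c v _ [r [w [sw dw hr hs]]] e _; have [k ck] := nuS c.
  exists r, (rcons w (x, Var F (n + k))); split=> //; last 2 [by exact: derives_havoc dw e _].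
  + rewrite -cats1; apply: stacked_cat sw _ => w2 d; rewrite cats1.
    exact: derives_havoc d e _.
  + move=> z zn; rewrite run_rcons /exec /upd; case: eqP => _ /=; last exact: hs.
    by rewrite (@run_out n) ?leq_addr ?hr // (derives_wf dw).
- move=> st q u s r' pr v _ [r [w [sw dw hr hs]]] e epr; exists r, w; split=> //.
  + exists w, [::]; rewrite cats0; split=> //; first exact: derives_start.
    by exists u.
  + exact: derives_enter dw e epr.
- move=> st q v s r' pr _ [r [w [sw dw hr hs]]] epr; exists r, w; split=> //.
  + case: sw => w1 [w2 [-> d [u' [/= e d1 sw1]]]].
    by apply: stacked_cat sw1 _ => w3 d3; exact: derives_call d3 e epr d.
  + by case: sw => w1 [w2 [-> d [u' [/= e d1 sw1]]]]; apply: derives_call d1 e epr d.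
Qed.

(** For same-level words the stack is arbitrary, so that the induction hypothesis for the callee can
    be used below any pending calls. *)
Lemma derives_reaches (H : pred nat) b u w : derives H b u w -> forall s, is_state ar n s ->
  (forall k, H k -> value ar (s (n + k))) ->
  if b then exists st, reaches ar p st u (run w s)
  else forall st pr, onth (procs p) u.1 = Some pr ->
    reaches ar p st (u.1, start pr) s -> reaches ar p st u (run w s).
Proof.
elim=> {b u w}.
- by move=> pr epr s iss _; exists [::]; apply: reaches_start.
- by move=> q pr epr s _ _ st pr' /= epr'; move: epr; rewrite epr' => -[<-].
- move=> b q u w x t v _ IH e s iss sv; rewrite run_rcons.
  have := IH s iss sv; case: b {IH} => [[st R]|R].
    by exists st; apply: reaches_assign R e.
  by move=> st pr epr R0; apply: reaches_assign (R st pr epr R0) e.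
- move=> b q u w x k v D IH e hk s iss sv; rewrite run_rcons /exec /=.
  have vk : value ar (run w s (n + k)) by rewrite (@run_out n) ?leq_addr ?(derives_wf D) ?sv.
  have := IH s iss sv; case: b {IH D} => [[st R]|R].
    by exists st; apply: reaches_havoc R e vk.
  by move=> st pr epr R0; apply: reaches_havoc (R st pr epr R0) e vk.
- move=> q u w r pr v _ IH e epr s iss sv; have [st R] := IH s iss sv.
  by exists ((q, v) :: st); apply: reaches_call R e epr.
- move=> b q u w r pr v w2 D IH e epr D2 IH2 s iss sv; rewrite run_cat.
  have := IH s iss sv.
  have sv' k : H k -> value ar (run w s (n + k)).
    by move=> hk; rewrite (@run_out n) ?leq_addr ?(derives_wf D) ?sv.
  case: b {IH D} => [[st R]|R].
    have := IH2 _ (reaches_is_state R) sv' ((q, v) :: st) pr epr (reaches_call R e epr).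
    by move=> R2; exists st; apply: reaches_return R2 epr.
  move=> st pr0 epr0 R0; have {}R := R st pr0 epr0 R0.
  have := IH2 _ (reaches_is_state R) sv' ((q, v) :: st) pr epr (reaches_call R e epr).
  by move=> R2; apply: reaches_return R2 epr.
Qed.

(** * Reduction to two sources of drawn values *)

Definition two : pred nat := [pred k | k < 2].

(** [th] takes the variable itself and not its offset from [n]; in [valid_iff] it is read off an
    instantiation of the variables. *)
Definition retag (th : nat ->
  nat) (z : nat) : term F := if z < n then Var F z else Var F (n + th z).
Definition retag_word th (w : word) : word := [seq (a.1, subst (retag th) a.2) | a <- w].

Lemma derives_retag th b u w : (forall z, two (th z)) ->
  derives predT b u w -> derives two b u (retag_word th w).
Proof.
move=> th2; elim=> {b u w} /=.
- exact: derives_main.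
- exact: derives_start.
- move=> b q u w x t v _ IH e; rewrite /retag_word map_rcons /=.
  suff -> : subst (retag th) t = t by exact: derives_assign IH e.
  have [_ _ /and3P[_ /andP[_ /allP vt] _] _ _] := wf_edge e.
  by apply: subst_Var_in => y /vt; rewrite /retag => ->.
- move=> b q u w x k v _ IH e _; rewrite /retag_word map_rcons /= /retag ltnNge leq_addr /=.
  exact: derives_havoc IH e _.
- by move=> q u w r pr v _ IH e epr; exact: derives_enter IH e epr.
- move=> b q u w r pr v w2 _ IH e epr _ IH2; rewrite /retag_word map_cat.
  exact: derives_call IH e epr IH2.
Qed.

Lemma run_retag th w r1 r2 : all wf_letter w ->
  (forall z, r1 z = subst r2 (retag th z)) ->
  forall z, z < n -> run w r1 z = run (retag_word th w) r2 z.
Proof.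
move=> ww E; suff E1 z : subst (run (retag_word th w) r2) (retag th z) = run w r1 z.
  by move=> z zn; rewrite -E1 /retag zn.
elim: w r1 r2 ww E => [|a w IH] r1 r2 /=; first by move=> _ ->.
case/andP=> wa ww E; apply: IH => // y; rewrite /exec /upd /=.
case: eqP => [->|ny]; rewrite /retag; last first.
  rewrite E /retag; case: ifP => //= _; first by case: eqP.
  by case: eqP => // ex; move: wa; rewrite /wf_letter -ex ltnNge leq_addr.
rewrite [_ < n]wa /= eqxx subst_comp; apply: eq_subst => x.
by rewrite E.
Qed.

Lemma derives_one_var H b u w : derives H b u w -> all (fun a : letter => at_most_one_var a.2) w.
Proof.
elim=> //= {b u w} [b q u w x t v _ IH /wf_edge[_ _ /and3P[_ _ am] _ _]|
  b q u w x k v _ IH _ _|b q u w r pr v w2 _ IH _ _ _ IH2].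
- by rewrite all_rcons IH andbT.
- by rewrite all_rcons IH andbT.
- by rewrite all_cat IH.
Qed.

Lemma at_most_one_var_wp w t : all (fun a : letter => at_most_one_var a.2) w ->
  at_most_one_var t -> at_most_one_var (wp w t).
Proof.
elim: w => //= -[x s] w IH /andP[/= ams amw] amt.
have /at_most_one_varP[y sy] := IH amw amt; rewrite /subst1 /=.
have [exy|nxy] := eqVneq y x.
  move/at_most_one_varP: ams => [z sz]; apply/at_most_one_varP; exists z => c.
  move=> /vars_subst[d /sy]; rewrite inE => /eqP->.
  by rewrite exy /upd eqxx; apply: sz.
apply/at_most_one_varP; exists y => c /vars_subst[d /sy]; rewrite inE => /eqP->.
by rewrite /upd (negPf nxy).
Qed.

(** Forward: executions whose initial values and draws are all [v1] or [v2] already separate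
    different one-variable terms. Backward: a word with arbitrarily many sources is tested by
    mapping every variable to one of the sources [n] and [n+1], and each such test is a test of a
    word over [two]. *)
Lemma valid_iff v1 v2 u e : value ar v1 -> value ar v2 -> v1 <> v2 -> two_var_equality ar n e ->
  valid_at ar p u e <-> forall w, derives two true u w -> wp w e.1 = wp w e.2.
Proof.
move=> vv1 vv2 n12 /and4P[wf1 am1 wf2 am2]; split=> [V w D|V st s R].
  have am := derives_one_var D.
  apply: (@two_values _ _ _ v1 v2); rewrite ?at_most_one_var_wp // => r rv.
  have vr z : value ar (r z) by case: (rv z) => ->.
  have iss : is_state ar n r by move=> z _.
  have [st] := derives_reaches D iss (fun k _ => vr (n + k)).
  by move/V; rewrite /holds !subst_run.
(* Sources are numbered by the codes of terms, so every value has a source. *)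
have nuS (c : term F) : exists k, odflt (Var F 0) (unpickle k) = c.
  by exists (pickle c); rewrite pickleK.
have [r [w [_ D _ hs]]] := reaches_derives nuS R.
have am := derives_one_var D.
rewrite /holds; have E t : wf_term ar n t -> subst s t = subst r (wp w t).
  case/andP=> _ /allP vt; rewrite -subst_run; apply: eq_subst_in => y /vt; exact: hs.
rewrite !E //; congr subst.
apply: (@two_values _ _ _ (Var F n) (Var F n.+1)); rewrite ?at_most_one_var_wp //.
  by move/eqP; rewrite Var_eq ltn_eqF.
(* The instantiation [r'] factors into the retagging by [th], which merges the sources, and [r2],
   which instantiates the program variables. *)
move=> r' r'2; pose th z : nat := (r' z == Var F n.+1).
pose r2 z := if z < n then r' z else Var F z.
have Er z : r' z = subst r2 (retag th z).
  rewrite /retag; case: ifP => zn /=; rewrite /r2 ?zn // ltnNge leq_addr /= /th.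
  by case: (r'2 z) => ->; rewrite ?eqxx ?addn1 // Var_eq ltn_eqF ?addn0.
have th2 z : two (th z) by rewrite /two /= /th; case: eqP.
rewrite -!subst_run.
have E' t : wf_term ar n t -> subst (run w r') t = subst r2 (wp (retag_word th w) t).
  case/andP=> _ /allP vt; rewrite -subst_run; apply: eq_subst_in => y /vt.
  by apply: run_retag => //; exact: derives_wf D.
by rewrite !E' // V //; apply: derives_retag.
Qed.

(** * Words of bounded derivation depth *)

Definition alledges : seq (nat * (nat * label F * nat)) :=
  flatten [seq [seq (q, e) | e <- edges (getp q)] | q <- iota 0 (size (procs p))].

Definition extend (db : seq item) (qe : nat * (nat * label F * nat)) (it : item) : seq item :=
  if it.1.2 == (qe.1, qe.2.1.1) then
    match qe.2.1.2 with
    | Assign x t => [:: ((it.1.1, (qe.1, qe.2.2)), rcons it.2 (x, t))]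
    | Havoc x => [:: ((it.1.1, (qe.1, qe.2.2)), rcons it.2 (x, Var F n));
                     ((it.1.1, (qe.1, qe.2.2)), rcons it.2 (x, Var F n.+1))]
    | Call r =>
        (if it.1.1 then [:: ((true, (r, start (getp r))), it.2)] else [::]) ++
        [seq ((it.1.1, (qe.1, qe.2.2)), it.2 ++ it2.2) |
           it2 <- db & it2.1 == (false, (r, ret (getp r)))]
    end
  else [::].

Definition step (db : seq item) : seq item :=
  db ++ flatten [seq flatten [seq extend db qe it | it <- db] | qe <- alledges].

Definition db0 : seq item :=
  ((true, (main p, start (getp (main p)))), [::]) ::
  [seq ((false, (q, start (getp q))), [::]) | q <- iota 0 (size (procs p))].

(** Each round combines all items found so far, so [k] bounds the height of derivation trees; the
    words themselves may become exponentially long in [k]. *)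
Definition db k : seq item := iter k step db0.

(** The grammar of the words in the abstract form used for the linear algebra: a premise followed by
    a fixed word, or, in [rule2], the concatenation of two premises. *)
Inductive rule1 : node -> word -> node -> Prop :=
| rule1_assign b q u x t v : edge p (q, u) (Assign x t) v -> rule1 (b, (q, u)) [:: (x, t)] (b,
  (q, v))
| rule1_havoc b q u x k v : edge p (q, u) (Havoc F x) v -> two k ->
    rule1 (b, (q, u)) [:: (x, Var F (n + k))] (b, (q, v))
| rule1_enter q u r v : edge p (q, u) (Call F r) v ->
    rule1 (true, (q, u)) [::] (true, (r, start (getp r))).

Inductive rule2 : node -> node -> node -> Prop :=
| rule2_call b q u r v : edge p (q, u) (Call F r) v ->
    rule2 (b, (q, u)) (false, (r, ret (getp r))) (b, (q, v)).

Lemma edgeP q e : reflect (edge p (q, e.1.1) e.1.2 e.2) ((q, e) \in alledges).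
Proof.
apply: (iffP idP) => [/flatten_mapP[q']|/wf_edge[/= qs _ _ _]].
  rewrite mem_iota add0n => /= qs /mapP[e' ei [-> ->]].
  by exists (getp q'); [exact: onth_some|case: e' ei => -[? ?] ? /= ?; apply/InP].
move=> ei; apply/flatten_mapP; exists q; first by rewrite mem_iota.
by apply/mapP; exists e => //; case: e ei => -[].
Qed.

Lemma mem_step d j w : reflect
  [\/ (j, w) \in d,
      exists i s w1, [/\ rule1 i s j, (i, w1) \in d & w = w1 ++ s]
    | exists i i' w1 w2, [/\ rule2 i i' j, (i, w1) \in d, (i', w2) \in d & w = w1 ++ w2]]
  ((j, w) \in step d).
Proof.
rewrite mem_cat; apply: (iffP orP) => [[|/flatten_mapP[[q e] /edgeP ee]]|].
- by constructor 1.
- case/flatten_mapP=> -[[b [q' u]] w1] id; rewrite /extend /=.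
  case: eqP => // -[eq' eu]; rewrite {q'}eq' {u}eu in id *.
  case: e ee id => [[u [x t|x|r]] v] /= ee id.
  + rewrite inE => /eqP[-> ->]; constructor 2.
    by exists (b, (q, u)), [:: (x, t)], w1; rewrite cats1; split=> //; constructor.
  + rewrite !inE => /orP[] /eqP[-> ->]; constructor 2.
      exists (b, (q, u)), [:: (x, Var F n)], w1; rewrite cats1; split=> //.
      by rewrite -[X in Var F X]addn0; constructor.
    exists (b, (q, u)), [:: (x, Var F n.+1)], w1; rewrite cats1; split=> //.
    by rewrite -[X in Var F X]addn1; constructor.
  + rewrite mem_cat => /orP[|/mapP[[i2 w2]]].
      case: b id => // id; rewrite inE => /eqP[-> ->]; constructor 2.
      by exists (true, (q, u)), [::], w1; rewrite cats0; split=> //; apply: rule1_enter ee.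
    rewrite mem_filter /= => /andP[/eqP-> i2d] [-> ->]; constructor 3.
    exists (b, (q, u)), (false, (r, ret (getp r))), w1, w2; split=> //.
- have mk q u l v it : edge p (q, u) l v -> it \in d -> (j, w) \in extend d (q, (u, l, v)) it ->
    (j, w) \in flatten [seq flatten [seq extend d qe it | it <- d] | qe <- alledges].
    move=> ee id ex; apply/flatten_mapP; exists (q, (u, l, v)); first exact/edgeP.
    by apply/flatten_mapP; exists it.
  case=> [|[i [s [w1 [r id ew]]]]|[i [i' [w1 [w2 [r id i'd ew]]]]]]; first by left.
    rewrite {w}ew in mk *; right; case: {i s j} r id mk => [b q u x t v|b q u x k v|q u r v] ee.
    + by move=> id mk; apply: (mk _ _ _ _ _ ee id); rewrite /extend /= eqxx cats1 inE.
    + case: k => [|[|//]] _ id mk; apply: (mk _ _ _ _ _ ee id);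
      by rewrite /extend /= eqxx cats1 ?addn0 ?addn1 !inE eqxx ?orbT.
    + by move=> id mk; apply: (mk _ _ _ _ _ ee id); rewrite /extend /= eqxx cats0 inE eqxx.
  rewrite {w}ew in mk *; right; case: {i i' j} r id i'd mk => b q u r v ee id i'd mk;
    apply: (mk _ _ _ _ _ ee id).
  rewrite /extend /= eqxx mem_cat; apply/orP; right; apply/mapP.
  by exists ((false, (r, ret (getp r))), w2) => //; rewrite mem_filter /= eqxx.
Qed.

Lemma db_mono k k' : k <= k' -> {subset db k <= db k'}.
Proof.
move=> /subnK <-; elim: (k' - k) => // d IH it /IH; rewrite addSn /=.
by rewrite mem_cat => ->.
Qed.

Lemma derives_db b u w : derives two b u w <-> exists k, ((b, u), w) \in db k.
Proof.
split.
  elim=> {b u w}.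
  - by move=> pr /onth_getp<-; exists 0; rewrite inE eqxx.
  - move=> q pr epr; exists 0; rewrite inE; apply/orP; right; apply/mapP.
    by exists q; rewrite ?mem_iota ?(onth_lt epr) // (onth_getp epr).
  - move=> b q u w x t v _ [k d] e; exists k.+1; apply/mem_step; constructor 2.
    by exists (b, (q, u)), [:: (x, t)], w; rewrite cats1; split=> //; constructor.
  - move=> b q u w x c v _ [k d] e c2; exists k.+1; apply/mem_step; constructor 2.
    by exists (b, (q, u)), [:: (x, Var F (n + c))], w; rewrite cats1; split=> //; constructor.
  - move=> q u w r pr v _ [k d] e /onth_getp<-; exists k.+1; apply/mem_step; constructor 2.
    by exists (true, (q, u)), [::], w; rewrite cats0; split=> //; apply: rule1_enter e.
  - move=> b q u w r pr v w2 _ [k d] e /onth_getp<- _ [k2 d2]; exists (maxn k k2).+1.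
    apply/mem_step; constructor 3; exists (b, (q, u)), (false, (r, ret (getp r))), w, w2.
    by split=> //; [exact: db_mono (leq_maxl _ _) _ d|exact: db_mono (leq_maxr _ _) _ d2].
case=> k; elim: k b u w => [|k IH] b u w.
  rewrite inE => /orP[/eqP[-> -> ->]|/mapP[q]].
    by apply: derives_main; apply: onth_some; case/andP: wfp.
  by rewrite mem_iota add0n => /= qs [-> -> ->]; apply: derives_start; exact: onth_some.
case/mem_step => [/IH //|[[b1 u1] [s [w1 [r /IH d ->{w}]]]]|].
  move Ei: (b1, u1) r => i r; move Ej: (b, u) r => j r.
  case: r Ei Ej d => {i s j} [b' q u' x t v e|b' q u' x c v e c2|q u' r v e] [-> ->] [-> ->] d.
  - by rewrite cats1; exact: derives_assign d e.
  - by rewrite cats1; exact: derives_havoc d e c2.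
  - have [_ _ rs _ _] := wf_edge e.
    by rewrite cats0; apply: derives_enter d e _; exact: onth_some.
case=> -[b1 u1] [[b2 u2] [w1 [w2 [r /IH d1 /IH d2 ->]]]].
move Ei: (b1, u1) r => i r; move Ei2: (b2, u2) r => i2 r; move Ej: (b, u) r => j r.
case: r Ei Ei2 Ej d1 d2 => {i i2 j} b' q u' r v e [-> ->] [-> ->] [-> ->] d1 d2.
have [_ _ rs _ _] := wf_edge e.
by apply: derives_call d1 e (onth_some rs) d2.
Qed.
End Language.

(** * Spans of context-free sets of matrices *)

Lemma bounded_stable (g : nat -> nat) N :
  (forall k, g k <= g k.+1) -> (forall k, g k <= N) -> exists2 k, k <= N & g k.+1 = g k.
Proof.
move=> mono bd; case: (boolP [exists k : 'I_N.+1, g k.+1 == g k]) => [/existsP[k /eqP e]|].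
  by exists k; rewrite // -ltnS.
rewrite negb_exists => /forallP str; suff /(_ N.+1 (leqnn _)) : forall k, k <= N.+1 -> k <= g k.
  by move/leq_trans/(_ (bd _)); rewrite ltnn.
elim=> // k IH kN; apply: leq_ltn_trans (IH (ltnW kN)) _.
by rewrite ltn_neqAle mono andbT eq_sym (str (Ordinal kN)).
Qed.

Section Span.
Import GRing.Theory.
Local Open Scope ring_scope.
Variables (K : fieldType) (d : nat) (I L : eqType).
Variables (R1 : I -> seq L -> I -> Prop) (R2 : I -> I -> I -> Prop).
Variable db : nat -> seq (I * seq L).
Hypothesis dbS : forall k j w, reflect
  [\/ (j, w) \in db k,
      exists i s w1, [/\ R1 i s j, (i, w1) \in db k & w = w1 ++ s]
    | exists i i' w1 w2, [/\ R2 i i' j, (i, w1) \in db k, (i', w2) \in db k & w = w1 ++ w2]]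
  ((j, w) \in db k.+1).
Variable idx : seq I.
Hypothesis db_idx : forall k i w, (i, w) \in db k -> i \in idx.
Variable h : L -> 'M[K]_d.

Definition mxword (w : seq L) : 'M[K]_d := foldr (fun a M => h a *m M) 1%:M w.

Lemma mxword_cat w1 w2 : mxword (w1 ++ w2) = mxword w1 *m mxword w2.
Proof. by elim: w1 => [|a w IH] /=; rewrite ?mul1mx // IH mulmxA. Qed.

Definition words k i : seq 'M[K]_d := [seq mxword it.2 | it <- db k & it.1 == i].
Definition wspan k i : {vspace 'M[K]_d} := <<words k i>>%VS.

Lemma mem_wspan k i w : (i, w) \in db k -> mxword w \in wspan k i.
Proof.
move=> h1; apply: memv_span; apply/mapP; exists (i, w) => //.
by rewrite mem_filter eqxx.
Qed.

Lemma wspan_sub k i (U : {vspace 'M[K]_d}) : (forall w, (i, w) \in db k -> mxword w \in U) ->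
  (wspan k i <= U)%VS.
Proof.
move=> H; apply/span_subvP => _ /mapP[[j w] + ->]; rewrite mem_filter /=.
by case/andP=> /eqP->; apply: H.
Qed.

Lemma span_image (X : seq 'M[K]_d) (f : {linear 'M[K]_d -> 'M[K]_d}) (U : {vspace 'M[K]_d}) v :
  v \in <<X>>%VS -> {in X, forall x, f x \in U} -> f v \in U.
Proof.
move=> /(coord_span (X := in_tuple X))-> fX; rewrite linear_sum; apply: memv_suml => i _.
by rewrite linearZ memvZ // fX // -tnth_nth mem_tnth.
Qed.

Lemma wspan_mono k i : (wspan k i <= wspan k.+1 i)%VS.
Proof. by apply: wspan_sub => w wd; apply: mem_wspan; apply/dbS; constructor 1. Qed.

(** Concatenation becomes matrix multiplication, which is bilinear, so the spans of one round
    determine those of the next. A binary rule is treated one factor at a time. Stationarity is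
    required at all nodes simultaneously, as the rules mix them. *)
Lemma wspan_stableS k : (forall i, wspan k.+1 i = wspan k i) -> forall i,
  wspan k.+2 i = wspan k.+1 i.
Proof.
move=> st j; apply/eqP; rewrite eqEsubv wspan_mono andbT; apply: wspan_sub => w.
case/dbS => [/mem_wspan //|[i [s [w1 [r /mem_wspan + ->]]]]|].
  rewrite (st i) mxword_cat => /(span_image (f := mulmxr (mxword s))); apply.
  move=> _ /mapP[[i' w'] + ->] /=; rewrite mem_filter /= => /andP[/eqP-> d'].
  by rewrite -mxword_cat; apply: mem_wspan; apply/dbS; constructor 2; exists i, s, w'.
case=> i [i' [w1 [w2 [r /mem_wspan + /mem_wspan + ->]]]]; rewrite (st i) (st i') mxword_cat.
move=> m1 m2; apply: (span_image (f := mulmxr (mxword w2)) m1).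
move=> _ /mapP[[i1 w1'] + ->] /=; rewrite mem_filter /= => /andP[/eqP-> d1].
apply: (span_image (f := mulmx (mxword w1')) m2).
move=> _ /mapP[[i2 w2'] + ->] /=; rewrite mem_filter /= => /andP[/eqP-> d2].
rewrite -mxword_cat; apply: mem_wspan; apply/dbS; constructor 3.
by exists i, i', w1', w2'.
Qed.

Lemma wspan_le k k' i : (k <= k')%N -> (wspan k i <= wspan k' i)%VS.
Proof.
move=> /subnK <-; elim: (k' - k)%N => // e IH; rewrite addSn.
exact: subv_trans IH (wspan_mono _ _).
Qed.

(* The dimensions of the spans are bounded, so these become stationary. *)
Lemma wspan_bound N k i w : (size idx * d ^ 2 <= N)%N ->
  (i, w) \in db k -> mxword w \in wspan N i.
Proof.
(* Summing the dimensions over all nodes makes the spans stationary at the same round: every summand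
   is monotone, so equal sums force equal dimensions. *)
move=> Nge; pose g k := (\sum_(i <- idx) \dim (wspan k i))%N.
have [k0 k0N gk0] : exists2 k, (k <= size idx * d ^ 2)%N & g k.+1 = g k.
  apply: bounded_stable => [k'|k']; first by apply: leq_sum => j _; rewrite dimvS ?wspan_mono.
  rewrite /g -sum1_size big_distrl /= big_seq [leqRHS]big_seq; apply: leq_sum => j _.
  rewrite mul1n expnS expn1; apply: leq_trans (dimvS (subvf _)) _.
  by rewrite dimvf /dim /=.
have st0 j : wspan k0.+1 j = wspan k0 j.
  have [jI|jI] := boolP (j \in idx); last first.
    have E k' : wspan k' j = <<[::]>>%VS.
      rewrite /wspan; suff -> : words k' j = [::] by [].
      rewrite /words -(@eq_in_filter _ pred0) ?filter_pred0 // => -[i' w'] d' /=.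
      by apply/esym/eqP => e; move: jI; rewrite -e (db_idx d').
    by rewrite !E.
  apply/esym/eqP; rewrite eqEdim wspan_mono /=.
  have := gk0; rewrite /g !(big_rem j jI) /= => e.
  have le : (\sum_(y <- rem j idx) \dim (wspan k0 y) <=
    \sum_(y <- rem j idx) \dim (wspan k0.+1 y))%N.
    by apply: leq_sum => y _; rewrite dimvS ?wspan_mono.
  by rewrite -(leq_add2r (\sum_(y <- rem j idx) \dim (wspan k0 y))) -e leq_add2l.
have stS e : forall j, wspan (e + k0).+1 j = wspan (e + k0) j.
  by elim: e => // e IH; exact: wspan_stableS IH.
have st e j : wspan (e + k0) j = wspan k0 j.
  by elim: e => // e IH; rewrite addSn stS.
move=> /mem_wspan; apply: subvP; have [kk0|/ltnW kk0] := leqP k k0.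
  by apply: wspan_le; apply: leq_trans kk0 (leq_trans k0N Nge).
rewrite -(subnK kk0) st; apply: wspan_le; exact: leq_trans k0N Nge.
Qed.

End Span.

(** * Linear relations between features of states *)

Section Transfer.
Import GRing.Theory.
Local Open Scope ring_scope.
Variables (K : fieldType) (I L : eqType).
Variables (R1 : I -> seq L -> I -> Prop) (R2 : I -> I -> I -> Prop).
Variable db : nat -> seq (I * seq L).
Hypothesis dbS : forall k j w, reflect
  [\/ (j, w) \in db k,
      exists i s w1, [/\ R1 i s j, (i, w1) \in db k & w = w1 ++ s]
    | exists i i' w1 w2, [/\ R2 i i' j, (i, w1) \in db k, (i', w2) \in db k & w = w1 ++ w2]]
  ((j, w) \in db k.+1).
Variables (idx : seq I) (ok : pred L).
Hypothesis db_idx : forall k i w, (i, w) \in db k -> i \in idx.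
Hypothesis db_ok : forall k i w, (i, w) \in db k -> all ok w.
Variables (J : finType) (S : Type) (stp : L -> S -> S) (good : S -> Prop).
Variables (phi : S -> J -> K) (c : L -> J -> J -> K).
Hypothesis good_stp : forall a s, ok a -> good s -> good (stp a s).
Hypothesis phi_stp : forall a s j, ok a -> good s ->
  phi (stp a s) j = \sum_i phi s i * c a i j.

Definition runs (w : seq L) (s : S) : S := foldl (fun s a => stp a s) s w.

(** Along a word the row of features is multiplied by the matrix of the word, so the relation [l] is
    a linear condition on that matrix. It passes from the matrices of depth at most [N] to their
    span, which contains all others. *)
Lemma transfer N s0 i (l : J -> K) : (size idx * #|J| ^ 2 <= N)%N -> good s0 ->
  (forall w, (i, w) \in db N -> \sum_j phi (runs w s0) j * l j = 0) ->
  forall k w, (i, w) \in db k -> \sum_j phi (runs w s0) j * l j = 0.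
Proof.
move=> Nge g0.
pose h a : 'M[K]_#|J| := \matrix_(i, j) c a (enum_val i) (enum_val j).
pose Phi s : 'rV[K]_#|J| := \row_j phi s (enum_val j).
have PhiS a s : ok a -> good s -> Phi (stp a s) = Phi s *m h a.
  move=> oka gs; apply/rowP => j;
    rewrite !mxE phi_stp // (reindex _ (onW_bij _ (@enum_val_bij J))) /=.
  by apply: eq_bigr => x _; rewrite !mxE.
have PhiW w s : all ok w -> good s -> Phi (runs w s) = Phi s *m mxword h w.
  elim: w s => [|a w IH] s /=; first by rewrite mulmx1.
  by case/andP=> oka okw gs; rewrite IH ?PhiS ?mulmxA //; exact: good_stp.
pose cl : 'cV[K]_#|J| := \col_j l (enum_val j).
have sumE s : (\sum_j phi s j * l j == 0) = (Phi s *m cl == 0).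
  have -> : Phi s *m cl = (\sum_j phi s j * l j)%:M.
    apply/matrixP => a b;
      rewrite !ord1 !mxE eqxx mulr1n (reindex _ (onW_bij _ (@enum_val_bij J))) /=.
    by apply: eq_bigr => x _; rewrite !mxE.
  by apply/eqP/eqP => [->|/matrixP/(_ 0 0)]; rewrite ?raddf0 // !mxE eqxx mulr1n.
move=> HN k w wd; apply/eqP; rewrite sumE PhiW ?(db_ok wd) // -mulmxA.
have := wspan_bound dbS db_idx h Nge wd.
move=> /(coord_span (X := in_tuple _))->; rewrite mulmx_suml mulmx_sumr.
apply/eqP; apply: big1 => x _; rewrite -scalemxAl -scalemxAr.
suff -> : Phi s0 *m ((in_tuple (words db h N i))`_x *m cl) = 0 by rewrite scaler0.
have := mem_tnth x (in_tuple (words db h N i)); rewrite (tnth_nth 0).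
case/mapP=> -[i' w'] + ->; rewrite mem_filter /= => /andP[/eqP-> d'].
by rewrite mulmxA -PhiW ?(db_ok d') //; apply/eqP; rewrite -sumE HN.
Qed.

End Transfer.

(** * Terms with exactly one variable as words *)

Section Mono.
Variable F : countType.
Implicit Types (s t u v : term F) (P Q S : seq (term F)).

Definition mvar t : nat := head 0 (vars t).
Definition mono t : bool := ~~ ground t && all (pred1 (mvar t)) (vars t).
Definition plug t v : term F := subst (fun _ => v) t.

Lemma mono_sub t : mono t -> {subset vars t <= [:: mvar t]}.
Proof. by case/andP=> _ /allP h z /h /=; rewrite inE. Qed.

Lemma mvar_in t : ~~ ground t -> mvar t \in vars t.
Proof. by rewrite /ground /mvar; case: (vars t) => //= z s _; rewrite inE eqxx. Qed.

Lemma monoP t : reflect (exists2 x, x \in vars t & {subset vars t <= [:: x]}) (mono t).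
Proof.
apply: (iffP idP) => [m|[x xt st]].
  by exists (mvar t); [apply: mvar_in; case/andP: m|exact: mono_sub].
have ng : ~~ ground t by apply/groundPn; exists x.
apply/andP; split=> //; apply/allP => z /st; rewrite inE => /eqP->.
by have := st _ (mvar_in ng); rewrite inE eq_sym.
Qed.

Lemma mono_mvar t x : mono t -> x \in vars t -> mvar t = x.
Proof. by move=> m /(mono_sub m); rewrite inE => /eqP. Qed.

Lemma mono_Var x : mono (Var F x).
Proof. by rewrite /mono /= eqxx. Qed.

Lemma subst_plug r t : mono t -> subst r t = plug t (r (mvar t)).
Proof. by move/mono_sub=> st; apply: subst1v st _. Qed.

Lemma ground_plug t v : ~~ ground v -> ground (plug t v) = ground t.
Proof.
move=> /groundPn[z zv]; apply/groundP/groundP => [g x|g x].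
  by apply: contra (g z) => xt; apply/vars_subst; exists x.
by apply/vars_subst => -[y yt]; rewrite (negPf (g y)) in yt.
Qed.

Lemma mono_plug t v : mono t -> mono v -> mono (plug t v).
Proof.
move=> /monoP[x xt _] /monoP[z zv sv]; apply/monoP; exists z.
  by apply/vars_subst; exists x.
by move=> y /vars_subst[_ _ /sv].
Qed.

Lemma mvar_plug t v : mono t -> mono v -> mvar (plug t v) = mvar v.
Proof.
move=> mt mv; apply: mono_mvar; first exact: mono_plug.
case/monoP: mt => x xt _; apply/vars_subst; exists x => //.
by apply: mvar_in; case/andP: mv.
Qed.

(** Right cancellation of plugging. A variable cannot face an application: if the latter is ground,
    so is [v], and otherwise its instance is larger than [v]. *)
Lemma plug_inj y v s t : ~~ ground v -> {subset vars s <= [:: y]} -> {subset vars t <= [:: y]} ->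
  plug s v = plug t v -> s = t.
Proof.
move=> gv; have L z g us : plug (Var F z) v <> plug (App g us) v.
  move=> e; have [gr|/groundPn[w wi]] := boolP (ground (App g us)).
    case/negP: gv; have -> // : v = App g us.
    by rewrite -[RHS](subst_ground (fun _ => v) gr).
  by have := tsz_subst_lt (fun _ => v) wi; rewrite -[subst _ _]/(plug _ _) -e ltnn.
elim/term_indS: s t => [x|f ts IH] [z|g us] ss st.
- by have := ss x; have := st z; rewrite !inE !eqxx => /(_ isT)/eqP-> /(_ isT)/eqP->.
- by move/L.
- by move/esym/L.
case=> -> /(@map_inj_in_eq _ _ (plug^~ v) (plug^~ v)) e; congr App; apply: e.
move=> a b ai bi; apply: IH => //= z zi.
  by apply: ss; apply: in_vars_App ai zi.
by apply: st; apply: in_vars_App bi zi.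
Qed.

(* The inner nodes on the path from the root to the leftmost variable. *)
Fixpoint spine t : seq (term F) :=
  match t with
  | Var _ => [::]
  | App f ts => t :: (fix go us :=
      match us with
      | [::] => [::]
      | u :: us' => if ground u then go us' else spine u
      end) ts
  end.

Lemma spine_App f ts : spine (App f ts) =
  App f ts :: (if [seq u <- ts | ~~ ground u] is u :: _ then spine u else [::]).
Proof. by rewrite /=; congr cons; elim: ts => //= u us ->; case: ground. Qed.

Lemma filter_hd (T : eqType) (a : pred T) (x : T) (r l : seq T) :
  [seq y <- l | a y] = x :: r -> x \in l /\ a x.
Proof.
move=> e; have : x \in [seq y <- l | a y] by rewrite e inE eqxx.
by rewrite mem_filter => /andP[].
Qed.

Lemma spine_in s t : s \in spine t -> ~~ ground t ->
  [/\ ~~ ground s, {subset vars s <= vars t}, tsz s <= tsz t & exists f ts, s = App f ts].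
Proof.
elim/term_indS: t => [x|f ts IH] //; rewrite spine_App inE => /orP[/eqP->|].
  by move=> g; split=> //; exists f, ts.
case e: (filter _ _) => [|u r] // si _; have [ui gu] := filter_hd e.
have [gs ss ls A] := IH _ ui si gu; split=> //.
  by move=> z /ss; apply: in_vars_App.
by apply: leq_trans ls (ltnW (tsz_arg _ ui)).
Qed.

Lemma spine_plug t v : ~~ ground t -> ~~ ground v ->
  spine (plug t v) = map (plug^~ v) (spine t) ++ spine v.
Proof.
move=> + gv; elim/term_indS: t => [x|f ts IH] // gt.
rewrite [plug _ _]/= !spine_App /=; congr cons.
rewrite filter_map (eq_filter (a2 := fun u => ~~ ground u)); last first.
  by move=> u /=; rewrite -/(plug u v) ground_plug.
case e: (filter _ _) => [|u r] /=; last first.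
  by have [ui gu] := filter_hd e; apply: IH.
move: gt; rewrite ground_App => /allPn[u ui gu].
by have := mem_filter (fun u => ~~ ground u) u ts; rewrite e in_nil gu ui.
Qed.

(** Topmost occurrences of members of [P] become pointers: the variables that replace them are
    positions in [P]. *)
Fixpoint abstr P u : term F :=
  if u \in P then Var F (seq.index u P) else
  match u with
  | Var x => Var F x
  | App f us => App f (map (abstr P) us)
  end.

Lemma abstrE P u : abstr P u = if u \in P then Var F (seq.index u P) else
  match u with Var x => Var F x | App f us => App f (map (abstr P) us) end.
Proof. by case: u. Qed.

Lemma abstrK P z u : Var F z \in P -> {subset vars u <= [:: z]} ->
  subst (nth (Var F 0) P) (abstr P u) = u.
Proof.
move=> zP; elim/term_indS: u => [x|f us IH] su; rewrite abstrE; case: ifP => [i|ni] /=;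
  rewrite ?nth_index //.
  by move: ni; have := su x; rewrite !inE eqxx => /(_ isT)/eqP->; rewrite zP.
congr App; rewrite -map_comp -[RHS]map_id; apply/eq_in_map => u ui; apply: IH => //.
by move=> w wi; apply: su; apply: in_vars_App ui wi.
Qed.

(* Every node of the spine becomes a letter in which the lower spine nodes are
   replaced by pointers; that makes the letters of [t] independent of what is
   plugged into [t]. *)
Fixpoint letters z P : seq (term F) :=
  if P is p :: P' then abstr (rcons P' (Var F z)) p :: letters z P' else [::].

Definition tletters t := letters (mvar t) (spine t).
Definition tword t : seq (term F) := rcons (tletters t) (Var F (mvar t)).

Lemma spine_head t : mono t -> exists P, rcons (spine t) (Var F (mvar t)) = t :: P.
Proof.
by case: t => [x|f ts] m; [exists [::]|rewrite spine_App; eexists; rewrite rcons_cons].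
Qed.

(** Decoding starts at the bottom of the spine: once the lower nodes are known, [abstrK] recovers a
    node from its letter. *)
Lemma letters_inj z P Q : letters z P = letters z Q ->
  {in P, forall p, {subset vars p <= [:: z]}} -> {in Q, forall p, {subset vars p <= [:: z]}} ->
    P = Q.
Proof.
elim: P Q => [|p P IH] [|q Q] //= [e1 e2] sP sQ.
have e : P = Q.
  by apply: IH => // r ri; [apply: sP|apply: sQ]; rewrite inE ri orbT.
rewrite -e in e1 *; congr cons.
have zP : Var F z \in rcons P (Var F z) by rewrite mem_rcons inE eqxx.
rewrite -(abstrK zP (sP p (mem_head _ _))) e1.
exact: abstrK zP (sQ q (mem_head _ _)).
Qed.

Lemma tword_inj s t : mono s -> mono t -> tword s = tword t -> s = t.
Proof.
move=> ms mt /rcons_inj[el [ez]].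
have sub u : mono u -> {in spine u, forall p, {subset vars p <= [:: mvar u]}}.
  by move=> mu p /spine_in[]; [case/andP: mu|move=> _ su _ _ z /su/(mono_sub mu)].
have e : spine s = spine t.
  by move: el; rewrite /tletters ez => /letters_inj; apply; [rewrite -ez|]; apply: sub.
have [P eP] := spine_head ms; have [Q eQ] := spine_head mt.
by move: eP; rewrite e ez eQ => -[].
Qed.

(** The pointer to [Var y] turns into a pointer to the root of [v], which has the same position. No
    other pointer arises: a ground subterm differs from all nodes of the spine of [v] and from its
    variable, and the instance of a non-ground application is larger than [v]. *)
Lemma abstr_plug y v S u : mono v ->
  {in S, forall p, [/\ ~~ ground p, {subset vars p <= [:: y]} & exists f ts, p = App f ts]} ->
  {subset vars u <= [:: y]} ->
  abstr (rcons (map (plug^~ v) S ++ spine v) (Var F (mvar v))) (plug u v) =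
  abstr (rcons S (Var F y)) u.
Proof.
move=> mv hS; have gv : ~~ ground v by case/andP: mv.
have szS p : p \in S -> tsz v < tsz (plug p v).
  by case/hS=> /groundPn[z zi] _ [f [ts ep]]; rewrite ep in zi *; apply: tsz_subst_lt zi.
have vnS : v \notin map (plug^~ v) S.
  by apply/mapP => -[p /szS + e]; rewrite -e ltnn.
elim/term_indS: u => [x|f us IH] su.
  have -> : x = y by have := su x; rewrite !inE eqxx => /(_ isT)/eqP.
  rewrite [RHS]abstrE mem_rcons inE eqxx [plug _ _]/= abstrE {su} /=.
  have [P eP] := spine_head mv; rewrite rcons_cat eP mem_cat inE eqxx orbT.
  rewrite index_cat (negPf vnS) /= eqxx addn0 size_map -cats1 index_cat.
  case: ifP => [|_]; last by rewrite /= eqxx addn0.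
  by case/hS=> _ _ [? [? ]].
rewrite abstrE [in RHS]abstrE.
have inS : (plug (App f us) v \in map (plug^~ v) S) = (App f us \in S).
  apply/mapP/idP => [[p pS e]|uS]; last by exists (App f us).
  by have [_ sp _] := hS p pS; rewrite (plug_inj gv su sp e).
have nsp : plug (App f us) v \notin rcons (spine v) (Var F (mvar v)).
  have [gr|ng] := boolP (ground (App f us)).
    rewrite /plug subst_ground // mem_rcons inE negb_or; apply/andP; split=> //.
    by apply/negP => /spine_in-/(_ gv)[]; rewrite gr.
  have lt : tsz v < tsz (plug (App f us) v).
    by case/groundPn: ng => z zi; apply: tsz_subst_lt zi.
  rewrite mem_rcons inE negb_or; apply/andP; split=> //.
  by apply/negP => /spine_in-/(_ gv)[_ _ + _]; rewrite leqNgt lt.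
rewrite rcons_cat mem_cat inS (negPf nsp) orbF mem_rcons inE.
have -> : (App f us == Var F y) = false by apply/eqP.
rewrite orFb.
have idx_cons (x p : term F) P :
  seq.index x (p :: P) = if p == x then 0 else (seq.index x P).+1 by [].
case: ifP => [uS|nS]; last first.
  rewrite /plug /=; congr App; rewrite -!map_comp; apply/eq_in_map => u ui;
    rewrite /= -rcons_cat; apply: IH => //.
  by move=> w wi; apply: su; apply: in_vars_App ui wi.
congr Var; rewrite index_cat inS uS -cats1 index_cat uS.
elim: S hS uS {szS vnS inS nsp IH} => // p S IHS hS; rewrite inE map_cons !idx_cons.
have [-> _|ne /= uS] := eqVneq (App f us) p; first by rewrite !eqxx.
have nep : (plug p v == plug (App f us) v) = false.
  apply/eqP => e; case/eqP: ne; have [_ sp _] := hS p (mem_head _ _).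
  exact/esym/(plug_inj gv sp su e).
by rewrite nep IHS // => q qS; apply: hS; rewrite inE qS orbT.
Qed.

(** With [tword_inj], this embeds plugging of one-variable terms into concatenation of words; the
    final letter of [t], its variable, is overwritten by the word of [v]. *)
Lemma tword_plug t v : mono t -> mono v -> tword (plug t v) = tletters t ++ tword v.
Proof.
move=> mt mv; have [gt gv] : ~~ ground t /\ ~~ ground v by case/andP: mt; case/andP: mv.
rewrite /tword {1}/tletters mvar_plug // spine_plug // -rcons_cat; congr rcons.
have : {in spine t, forall p, [/\ ~~ ground p, {subset vars p <= [:: mvar t]} & exists f ts,
  p = App f ts]}.
  move=> p /spine_in/(_ gt)[gp sp _ A]; split=> // z /sp; exact: mono_sub.
rewrite /tletters; elim: (spine t) => //= p S IH hS; congr cons; last first.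
  by apply: IH => q qS; apply: hS; rewrite inE qS orbT.
have [_ sp _] := hS p (mem_head _ _); apply: abstr_plug => //.
by move=> q qS; apply: hS; rewrite inE qS orbT.
Qed.

End Mono.

(** * Words as polynomials *)

Section Num.
Import GRing.Theory.
Local Open Scope ring_scope.
Variable F : countType.
Implicit Types (s t v : term F).

Notation K := {fraction {poly rat}}.

(** The successor keeps digits nonzero, so that the last letter of a word survives as a leading
    coefficient and the polynomial determines the word. *)
Definition digit (t : term F) : rat := (pickle t).+1%:R.

Lemma digit_inj : injective digit.
Proof.
by move=> s t /eqP; rewrite Num.Theory.eqr_nat => /eqP[] /(pcan_inj pickleK).
Qed.

Lemma digit_neq0 t : digit t != 0.
Proof. by rewrite Num.Theory.pnatr_eq0. Qed.

Definition num t : K := tofrac (Poly (map digit (tword t))).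
Definition num_scale t : K := tofrac 'X^(size (tletters t)).
Definition num_shift t : K := tofrac (Poly (map digit (tletters t))).

Lemma Poly_cat (l1 l2 : seq rat) : Poly (l1 ++ l2) = Poly l1 + 'X^(size l1) * Poly l2.
Proof.
have Poly_cons (a : rat) l : Poly (a :: l) = Poly l * 'X + a%:P by exact: cons_poly_def.
elim: l1 => [|a l IH]; first by rewrite add0r expr0 mul1r.
rewrite [LHS](Poly_cons a (l ++ l2)) IH Poly_cons exprSr mulrDl [RHS]addrAC.
by rewrite -[in RHS]mulrA ['X * _]mulrC mulrA.
Qed.

(** The letters of [t] are the low coefficients, and those of [v] are shifted by a power of the
    indeterminate. So an assignment acts as an affine map. *)
Lemma num_plug t v : mono t -> mono v -> num (plug t v) = num_shift t + num_scale t * num v.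
Proof.
move=> mt mv; rewrite /num tword_plug // map_cat Poly_cat size_map.
by rewrite tofracD tofracM.
Qed.

Lemma num_inj s t : mono s -> mono t -> num s = num t -> s = t.
Proof.
move=> ms mt /eqP; rewrite tofrac_eq => /eqP e; apply: tword_inj => //.
have polyw u : polyseq (Poly (map digit (tword u))) = map digit (tword u).
  by rewrite (@PolyK _ 1) // /tword map_rcons last_rcons digit_neq0.
by apply: (inj_map digit_inj); rewrite -[LHS]polyw e polyw.
Qed.
End Num.

(** * Depth of terms *)

Section Depth.
Variable F : countType.
Implicit Types (s t u v : term F).

Fixpoint tdepth t : nat :=
  match t with Var _ => 0 | App _ ts => (foldr maxn 0 (map tdepth ts)).+1 end.

Lemma tdepth_arg f (ts : seq (term F)) t : t \in ts -> tdepth t < tdepth (App f ts).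
Proof.
rewrite /= ltnS; elim: ts => //= s ts IH; rewrite inE => /orP[/eqP->|/IH h].
  exact: leq_maxl.
exact: leq_trans h (leq_maxr _ _).
Qed.

Lemma tdepth_App_le f (ts : seq (term F)) k :
  {in ts, forall t, tdepth t <= k} -> tdepth (App f ts) <= k.+1.
Proof.
rewrite /= ltnS; elim: ts => //= s ts IH h; rewrite geq_max h ?mem_head // IH // => t ti.
by apply: h; rewrite inE ti orbT.
Qed.

Lemma tdepth_subst_ge r t z : z \in vars t -> tdepth (r z) <= tdepth (subst r t).
Proof.
elim/term_indS: t => [x|f ts IH]; first by rewrite inE => /eqP->.
case/vars_App=> t tin zt; apply: leq_trans (IH _ tin zt) (ltnW (tdepth_arg _ _)).
exact: map_f.
Qed.

Lemma tdepth_plug_le t v : tdepth (plug t v) <= tdepth t + tdepth v.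
Proof.
elim/term_indS: t => [x|f ts IH] //; rewrite [plug _ _]/= addSn.
apply: tdepth_App_le => _ /mapP[t ti ->]; apply: leq_trans (IH _ ti) _.
by rewrite leq_add2r -ltnS; apply: tdepth_arg ti.
Qed.

Lemma tdepth_plug_gt f (ts : seq (term F)) v : ~~ ground (App f ts) ->
  tdepth v < tdepth (plug (App f ts) v).
Proof.
case/groundPn=> z /vars_App[t ti zt]; apply: leq_ltn_trans (tdepth_subst_ge (fun _ => v) zt) _.
by apply: tdepth_arg; apply: map_f.
Qed.

(** Every occurrence of a variable lies at depth at least [k]; branches that end in a constant
    impose nothing. *)
Fixpoint deep k t : bool :=
  match k, t with
  | 0, _ => true
  | k'.+1, Var _ => false
  | k'.+1, App _ ts => all (deep k') ts
  end.

Lemma deepS k t : deep k.+1 t -> deep k t.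
Proof.
elim: k t => // k IH [] // f ts /= /allP h; apply/allP => t /h; exact: IH.
Qed.

Lemma deep_plug k t v : deep k v -> deep k (plug t v).
Proof.
elim/term_indS: t k => [x|f ts IH] // [|k] // dv; apply/allP => _ /mapP[t ti ->].
by apply: IH => //; apply: deepS.
Qed.

Lemma deep_plugS k f (ts : seq (term F)) v : deep k v -> deep k.+1 (plug (App f ts) v).
Proof. by move=> dv; apply/allP => _ /mapP[t ti ->]; apply: deep_plug. Qed.

Lemma deep_le k r t c : deep k (subst r t) -> c \in vars t -> r c = Var F c -> k <= tdepth t.
Proof.
elim/term_indS: t k => [x|f ts IH] [|k] // dk ct rc.
  by move: ct dk; rewrite inE => /eqP<-; rewrite [subst _ _]/= rc.
move: dk ct => /allP dk /vars_App[t ti ct]; apply: leq_trans (tdepth_arg f ti); rewrite ltnS.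
by apply: IH ct rc => //; apply: dk; apply: map_f.
Qed.
End Depth.

Lemma subterm_tsz (F : countType) (s t : term F) : subterm s t -> tsz s <= tsz t.
Proof.
by elim=> // f ts u /InP ui _ h; apply: leq_trans h (ltnW (tsz_arg f ui)).
Qed.

Lemma subterm_trans (F : countType) (s t u : term F) : subterm s t -> subterm t u -> subterm s u.
Proof. by move=> st; elim=> // f ts v vi _ h; exact: subterm_arg vi h. Qed.

Lemma subterm_subst (F : countType) (r : nat -> term F) t z : z \in vars t ->
  subterm (r z) (subst r t).
Proof.
elim/term_indS: t => [x|f ts IH]; first by rewrite inE => /eqP->; left.
case/vars_App=> t ti zt; apply: subterm_arg (IH _ ti zt); apply/InP; exact: map_f.
Qed.

(** * Initial values as variables *)

Section Initial.
Variables (F : countType) (ar : F -> nat) (p : program F).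
Hypotheses (wfp : wf_program ar p) (initp : init_restricted p).
Let n := nvars p.

Definition plets : seq (letter F) :=
  flatten [seq match qe.2.1.2 with
               | Assign x t => [:: (x, t)]
               | Havoc x => [:: (x, Var F n); (x, Var F n.+1)]
               | Call _ => [::]
               end | qe <- alledges p].

Definition inits : seq (term F) := [seq a.2 | a <- plets & ground a.2].
(** Variables below [n] denote initial values of the program variables, [n] and [n+1] the two
    sources of havocs, and those from [n+2] up to [m] the elements of [inits]. *)
Let m := n.+2 + size inits.

Lemma pletsP a : a \in plets ->
  [/\ a.1 < n, all (fun z => z < n.+2) (vars a.2), at_most_one_var a.2 &
    is_rhs p a.2 \/ (a.2 = Var F n \/ a.2 = Var F n.+1)].
Proof.
case/flatten_mapP=> -[q [[u l] v]] /(edgeP wfp) /= e; case: l e => [x t|x|//] e.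
  have [_ _ /and3P[xn /andP[_ vt] am] _ _] := wf_edge wfp e.
  rewrite inE => /eqP-> /=; split=> //; last by left; exists (q, u), x, v.
  by apply: sub_all vt => z zn; apply: ltnW; apply: ltnW.
have [_ _ xn _ _] := wf_edge wfp e.
by rewrite !inE => /orP[]/eqP->; split=> //=; rewrite ?ltnS ?leqnn ?leqnSn //=; right; [left|right].
Qed.

Lemma db_plets k i w : (i, w) \in db p k -> all (mem plets) w.
Proof.
case: i => b u wd; have /(derives_db wfp) : exists k, ((b, u), w) \in db p k by exists k.
elim=> //= {b u w wd}.
- move=> b q u w x t v _ IH e; rewrite all_rcons IH andbT /=; apply/flatten_mapP.
  by exists (q, (u, Assign x t, v)); rewrite ?inE //; apply/(edgeP wfp).
- move=> b q u w x c v _ IH e c2; rewrite all_rcons IH andbT /=; apply/flatten_mapP.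
  exists (q, (u, Havoc F x, v)); first exact/(edgeP wfp).
  by case: c c2 => [|[|]] // _; rewrite ?addn0 ?addn1 !inE eqxx ?orbT.
- by move=> b q u w r pr v w2 _ IH _ _ _ IH2; rewrite all_cat IH.
Qed.

Lemma inits_in t : t \in inits -> in_R p t.
Proof.
case/mapP=> a; rewrite mem_filter => /andP[g /pletsP[_ _ _ h]] ->; split=> //.
by case: h => // -[] e; move: g; rewrite e.
Qed.

Lemma inits_ground t : t \in inits -> ground t.
Proof. by case/inits_in. Qed.

Lemma inits_sub r t : r \in inits -> t \in inits -> subterm r t -> r = t.
Proof.
case: initp => _ h /inits_in ri /inits_in ti rt.
by apply/eqP/negPn/negP => /eqP ne; apply: h ri ti _.
Qed.

(** This is where the first half of initialization-restriction is used: an element of R inside a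
    non-ground right-hand side would belong to G. *)
Lemma inits_sep a u : a \in plets -> ~~ ground a.2 -> subterm u a.2 -> u \notin inits.
Proof.
case: initp => h _ ai ng ua; apply/negP => ui; have [_ gu] := inits_in ui.
have [_ _ _ [rhs|e]] := pletsP ai; first by apply: (h u); split; [exact: inits_in|split=> //;
  exists a.2].
have : subterm u (Var F n) \/ subterm u (Var F n.+1) by case: e ua => ->; auto.
by case=> s; inversion s; subst; move: gu.
Qed.

Fixpoint alpha u : term F :=
  if u \in inits then Var F (n.+2 + seq.index u inits) else
  match u with
  | Var x => Var F x
  | App f us => App f (map alpha us)
  end.

Lemma alphaE u : alpha u = if u \in inits then Var F (n.+2 + seq.index u inits) else
  match u with Var x => Var F x | App f us => App f (map alpha us) end.
Proof. by case: u. Qed.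

Lemma alpha_Var x : alpha (Var F x) = Var F x.
Proof. by rewrite alphaE; case: ifP => // /inits_ground. Qed.

Lemma alpha_id t : (forall u, subterm u t -> u \notin inits) -> alpha t = t.
Proof.
elim/term_indS: t => [x|f ts IH] h; rewrite ?alpha_Var // alphaE (negPf (h _ (subterm_refl _))).
congr App; rewrite -[RHS]map_id; apply/eq_in_map => t ti; apply: IH => // u ut.
by apply: h; apply: subterm_arg ut; apply/InP.
Qed.

Lemma alpha_mono a : a \in plets -> mono (alpha a.2).
Proof.
move=> ai; have [g|ng] := boolP (ground a.2).
  have -> : alpha a.2 = Var F (n.+2 + seq.index a.2 inits).
    by rewrite alphaE ifT // map_f // mem_filter g.
  exact: mono_Var.
rewrite alpha_id; last by move=> u; exact: inits_sep.
have [_ _ /at_most_one_varP[x sx] _] := pletsP ai; case/groundPn: ng => z zi.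
by apply/monoP; exists z => // c /sx; move: (sx _ zi); rewrite !inE => /eqP-> /eqP->.
Qed.

Lemma alpha_vars u z : z \in vars (alpha u) -> z \in vars u \/ n.+2 <= z < m.
Proof.
elim/term_indS: u => [x|f us IH]; first by rewrite alpha_Var; left.
rewrite alphaE; case: ifP => [ui|_].
  by rewrite inE => /eqP->; right; rewrite leq_addr ltn_add2l index_mem.
case/vars_App=> _ /mapP[u ui ->] /(IH _ ui) [zu|]; last by right.
by left; apply: in_vars_App ui zu.
Qed.

Lemma tdepth_alpha u : tdepth (alpha u) <= tdepth u.
Proof.
elim/term_indS: u => [x|f us IH]; first by rewrite alpha_Var.
rewrite alphaE; case: ifP => // _; apply: tdepth_App_le => _ /mapP[u ui ->].
by apply: leq_trans (IH _ ui) _; rewrite -ltnS; apply: tdepth_arg ui.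
Qed.

Definition beta z : term F := if z < n.+2 then Var F z else nth (Var F 0) inits (z - n.+2).

Lemma alphaK u : all (fun z => z < n.+2) (vars u) -> subst beta (alpha u) = u.
Proof.
elim/term_indS: u => [x|f us IH] /allP h.
  by rewrite alpha_Var /= /beta h ?inE.
rewrite alphaE; case: ifP => [ui|_] /=.
  by rewrite /beta ltnNge leq_addr /= addKn nth_index.
congr App; rewrite -map_comp -[RHS]map_id; apply/eq_in_map => u ui; apply: IH => //.
by apply/allP => z zu; apply: h; apply: in_vars_App ui zu.
Qed.

(** The invariant of the values in a run: each goes back to an initial value, a draw or an element
    of R. A ground term without an element of R inside could complete a larger term to an element of
    R by accident. *)
Definition anchored t := ~~ ground t \/ exists2 r, r \in inits & subterm r t.

Lemma anchored_sub s t : subterm s t -> anchored s -> anchored t.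
Proof.
move=> st [/groundPn[z zs]|[r ri rs]]; last by right; exists r => //; exact: subterm_trans rs st.
left; apply/groundPn; exists z; elim: st zs => // f ts u /InP ui _ h /h; exact: in_vars_App.
Qed.

(* This is where the second half of initialization-restriction is used: no
   element of R arises by accident as an instance of a larger term. *)
Lemma anchored_notin r f us z : z \in vars (App f us) -> anchored (r z) ->
  subst r (App f us) \notin inits.
Proof.
move=> zi az; apply/negP => si; case: az => [/groundPn[c ci]|[s s1 s2]].
  by have /groundP/(_ c)/negP := inits_ground si; apply; apply/vars_subst; exists z.
have := tsz_subst_lt r zi; rewrite -(inits_sub s1 si _) ?ltnNge ?subterm_tsz //.
exact: subterm_trans s2 (subterm_subst r zi).
Qed.

(** By [anchored_notin] a substitution creates no new element of R above the substituted values, so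
    [alpha] passes through it. The last hypothesis keeps the variables that stand for elements of R
    fixed. *)
Lemma alpha_subst r u : all (fun z => z < n.+2) (vars u) -> (forall z, anchored (r z)) ->
  (forall z, n.+2 <= z -> r z = Var F z) ->
  alpha (subst r u) = subst (fun z => alpha (r z)) (alpha u).
Proof.
move=> + ra rv; elim/term_indS: u => [x|f us IH] /allP vu.
  by rewrite alpha_Var.
have [ui|ui] := boolP (App f us \in inits).
  by rewrite subst_ground ?inits_ground // alphaE ui /= rv ?leq_addr // alpha_Var.
have sui : subst r (App f us) \notin inits.
  have [g|/groundPn[z zi]] := boolP (ground (App f us)); first by rewrite subst_ground.
  exact: anchored_notin zi (ra z).
rewrite [in RHS]alphaE (negPf ui) alphaE (negPf sui) /=; congr App.
rewrite -!map_comp; apply/eq_in_map => u uin; apply: IH => //.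
by apply/allP => z zu; apply: vu; apply: in_vars_App uin zu.
Qed.

Definition aexec (a : letter F) (s : state F) : state F := exec (a.1, alpha a.2) s.
Definition arun (w : seq (letter F)) : state F := runs aexec w (@Var F).

Lemma arun_spec w : all (mem plets) w ->
  [/\ forall z, anchored (run w (@Var F) z), forall z, n <= z -> run w (@Var F) z = Var F z &
      forall z, alpha (run w (@Var F) z) = arun w z].
Proof.
elim/last_ind: w => [_|w a IH].
  by split=> // z; [left; rewrite /ground|rewrite alpha_Var].
rewrite all_rcons => /andP[/= ai /IH[anw vw ew]]; have [an va _ _] := pletsP ai.
rewrite run_rcons /arun /runs -cats1 foldl_cat /= -/(runs _ _ _) -/(arun w); split.
- move=> z; rewrite /exec /upd; case: eqP => // _.
  have [g|/groundPn[y yi]] := boolP (ground a.2).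
    rewrite subst_ground //; right; exists a.2; last by left.
    by apply: map_f; rewrite mem_filter g.
  exact: anchored_sub (subterm_subst _ yi) (anw y).
- by move=> z zn; rewrite /exec /upd gtn_eqF ?vw // (leq_trans an zn).
- move=> z; rewrite /aexec /exec /upd; case: eqP => //= _.
  rewrite alpha_subst //; first exact: eq_subst.
  by move=> y yn; apply: vw; apply: leq_trans yn; rewrite leqW.
Qed.

(** [alpha] is injective on terms over the variables below [n+2], with inverse [beta], so nothing is
    lost by comparing abstracted values. *)
Lemma arun_eq w s t : all (mem plets) w ->
  all (fun z => z < n) (vars s) -> all (fun z => z < n) (vars t) ->
  wp w s = wp w t <-> subst (arun w) (alpha s) = subst (arun w) (alpha t).
Proof.
move=> ww; have [anw vw ew] := arun_spec ww.
have lt u : all (fun z => z < n) (vars u) -> all (fun z => z < n.+2) (vars u).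
  by apply: sub_all => z zn; rewrite ltnW // ltnW.
have E u : all (fun z => z < n) (vars u) -> subst (arun w) (alpha u) = alpha (wp w u).
  move=> vu; rewrite -[wp w u]subst_Var -subst_run alpha_subst ?lt //.
    by apply: eq_subst => z; rewrite ew.
  by move=> y yn; apply: vw; apply: leq_trans yn; rewrite leqW.
have V u : all (fun z => z < n) (vars u) -> all (fun z => z < n.+2) (vars (wp w u)).
  move=> /lt; elim: w ww {anw vw ew E} => //= a w IH /andP[ai ww] vu.
  apply/allP => z /vars_subst[y /(allP (IH ww vu)) yn]; rewrite /upd; case: eqP => _.
    by have [_ /allP va _ _] := pletsP ai; apply: va.
  by rewrite inE => /eqP->.
move=> vs vt; rewrite !E //; split=> [->//|e].
by rewrite -(alphaK (V s vs)) e alphaK ?V.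
Qed.

End Initial.

(** * Bounded derivations suffice *)

Section Bound.
Import GRing.Theory.
Local Open Scope ring_scope.
Variables (F : countType) (ar : F -> nat) (p : program F).
Hypotheses (wfp : wf_program ar p) (initp : init_restricted p).
Notation K := {fraction {poly rat}}.
Let n := nvars p.
Let m := (n.+2 + size (inits p))%N.

Definition points : seq point :=
  flatten [seq [seq (q, u) | u <- iota 0 (npoints (getp p q))] | q <- iota 0 (size (procs p))].
Definition indices : seq node := [seq (true, u) | u <- points] ++ [seq (false, u) | u <- points].

Lemma mem_points q u : (q < size (procs p))%N -> (u < npoints (getp p q))%N -> (q, u) \in points.
Proof.
move=> hq hu; apply/flatten_mapP; exists q; first by rewrite mem_iota.
by apply/mapP; exists u; rewrite ?mem_iota.
Qed.

Lemma db_indices k i w : (i, w) \in db p k -> i \in indices.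
Proof.
case: i => b u wd; have /(derives_db wfp) D : exists k, ((b, u), w) \in db p k by exists k.
suff : u \in points.
  by move=> up; rewrite mem_cat; case: b {D wd}; rewrite map_f ?orbT.
elim: D => //= {b u w wd}.
- move=> pr e; have h := onth_lt e; apply: mem_points => //.
  by have /and3P[] := wf_proc wfp h; rewrite (onth_getp e).
- move=> q pr e; have h := onth_lt e; apply: mem_points => //.
  by have /and3P[] := wf_proc wfp h; rewrite (onth_getp e).
- by move=> b q u w x t v _ _ /(wf_edge wfp)[? _ _ ? _]; apply: mem_points.
- by move=> b q u w x k' v _ _ /(wf_edge wfp)[? _ _ ? _] _; apply: mem_points.
- move=> q u w r pr v _ _ _ e; have h := onth_lt e; apply: mem_points => //.
  by have /and3P[] := wf_proc wfp h; rewrite (onth_getp e).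
- by move=> b q u w r pr v w2 _ _ /(wf_edge wfp)[? _ _ ? _] _ _ _; apply: mem_points.
Qed.

Lemma db_transfer (J : finType) (good : state F -> Prop) (phi : state F -> J -> K)
    (c : letter F -> J -> J -> K) N i (l : J -> K) :
  (forall a s, a \in plets p -> good s -> good (aexec p a s)) ->
  (forall a s j, a \in plets p -> good s ->
    phi (aexec p a s) j = \sum_i phi s i * c a i j) ->
  good (@Var F) -> (size indices * #|J| ^ 2 <= N)%N ->
  (forall w, (i, w) \in db p N -> \sum_j phi (arun p w) j * l j = 0) ->
  forall k w, (i, w) \in db p k -> \sum_j phi (arun p w) j * l j = 0.
Proof.
move=> gS phiS g0 Nge HN.
have dbS k j w := mem_step wfp (db p k) j w.
exact: (transfer dbS db_indices (db_plets wfp) gS phiS Nge g0 HN).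
Qed.

Lemma sum_delta (J : finType) (f : J -> K) (a : J) (d : K) :
  \sum_j f j * ((j == a)%:R * d) = f a * d.
Proof.
rewrite (bigD1 a) //= eqxx mul1r big1 ?addr0 // => j /negPf->.
by rewrite mul0r mulr0.
Qed.

Lemma sum_delta1 (J : finType) (f : J -> K) (a : J) : \sum_j f j * (j == a)%:R = f a.
Proof. by rewrite -[RHS]mulr1 -sum_delta; apply: eq_bigr => j _; rewrite mulr1. Qed.

Lemma aletter_lt a : a \in plets p -> (mvar (alpha p a.2) < m)%N.
Proof.
move=> ai; have /andP[ng _] := alpha_mono wfp initp ai.
have [] := alpha_vars wfp (mvar_in ng); last by case/andP=> _ h; exact: h.
have [_ /allP va _ _] := pletsP wfp ai; move=> /va h; exact: leq_trans h (leq_addr _ _).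
Qed.

Lemma aexec_plug a s : a \in plets p ->
  subst s (alpha p a.2) = plug (alpha p a.2) (s (mvar (alpha p a.2))).
Proof. by move=> ai; apply: subst_plug; apply: (alpha_mono wfp initp ai). Qed.

(** The coordinate [None] is the constant 1, which makes affine maps linear. *)
Definition num_feature (s : state F) (j : option 'I_m) : K :=
  if j is Some z then num (s z) else 1.

Definition num_coef (a : letter F) (i j : option 'I_m) : K :=
  if j is Some z then
    if z == a.1 :> nat then
      if i is Some y then (y == mvar (alpha p a.2) :> nat)%:R * num_scale (alpha p a.2)
      else num_shift (alpha p a.2)
    else (i == j)%:R
  else (i == j)%:R.

Definition good_num (s : state F) : Prop := forall z, mono (s z).

Lemma good_num_aexec a s : a \in plets p -> good_num s -> good_num (aexec p a s).
Proof.
move=> ai gs z; rewrite /aexec /exec /upd; case: eqP => // _ /=.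
by rewrite aexec_plug // mono_plug // (alpha_mono wfp initp).
Qed.

Lemma num_feature_aexec a s j : a \in plets p -> good_num s ->
  num_feature (aexec p a s) j = \sum_i num_feature s i * num_coef a i j.
Proof.
move=> ai gs; case: j => [z|] /=; last by rewrite sum_delta1.
rewrite /aexec /exec /upd /=; case: eqP => [ez|_]; last by rewrite sum_delta1.
rewrite aexec_plug // num_plug //; last exact: (alpha_mono wfp initp ai).
rewrite (bigD1 None) //= mul1r; congr (_ + _).
rewrite (bigD1 (Some (Ordinal (aletter_lt ai)))) //= eqxx mul1r mulrC big1 ?addr0 //.
case=> // y /andP[_ ny]; suff -> : (y == mvar (alpha p a.2) :> nat) = false by rewrite mul0r mulr0.
by apply: contraNF ny => /eqP e; apply/eqP; congr Some; apply: val_inj.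
Qed.

Lemma num_bound N i (x y : 'I_m) (A B : K) : (size indices * m.+1 ^ 2 <= N)%N ->
  (forall w, (i, w) \in db p N -> num (arun p w x) = A + B * num (arun p w y)) ->
  forall k w, (i, w) \in db p k -> num (arun p w x) = A + B * num (arun p w y).
Proof.
move=> Nge HN k w wd.
pose l (j : option 'I_m) : K :=
  (j == Some x)%:R - ((j == None)%:R * A + (j == Some y)%:R * B).
have lE s : \sum_j num_feature s j * l j = num (s x) - (A + B * num (s y)).
  under eq_bigr => j _ do rewrite mulrBr mulrDr.
  by rewrite sumrB big_split /= !sum_delta sum_delta1 /= mul1r [_ * B]mulrC.
apply/eqP; rewrite -subr_eq0 -lE; apply/eqP.
apply: (db_transfer (N := N) good_num_aexec num_feature_aexec) wd.
- by move=> z; exact: mono_Var.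
- by rewrite card_option card_ord.
- by move=> w' wd'; rewrite lE (HN _ wd') subrr.
Qed.

(** Unreachability is the validity of the relation [1 = 0] on the constant coordinate. *)
Lemma empty_bound N i : (size indices * m.+1 ^ 2 <= N)%N ->
  (forall w, (i, w) \notin db p N) -> forall k w, (i, w) \notin db p k.
Proof.
move=> Nge HN k w; apply/negP => wd.
suff : \sum_j num_feature (arun p w) j * (j == None)%:R = 0.
  by rewrite sum_delta1 => /eqP; rewrite oner_eq0.
apply: (db_transfer (N := N) good_num_aexec num_feature_aexec) wd.
- by move=> z; exact: mono_Var.
- by rewrite card_option card_ord.
- by move=> w' wd'; case/negP: (HN w').
Qed.

Fixpoint enumD k : seq (term F) :=
  match k with
  | 0 => [seq Var F z | z <- iota 0 m]
  | k'.+1 => enumD k' ++ [seq plug (alpha p a.2) v | a <- plets p, v <- enumD k']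
  end.

Lemma enumD_mono k k' : (k <= k')%N -> {subset enumD k <= enumD k'}.
Proof.
move=> /subnK <-; elim: (k' - k)%N => // e IH v /IH; rewrite addSn /=.
by rewrite mem_cat => ->.
Qed.

(** Letters that are variables change nothing, and any other letter raises the depth, so [tdepth v]
    rounds suffice to produce [v]. *)
Lemma enumD_depth k v : v \in enumD k -> v \in enumD (tdepth v).
Proof.
elim: k v => [|k IH] v; first by case/mapP=> z zi ->; apply/mapP; exists z.
rewrite /= mem_cat => /orP[/IH //|/allpairsP[[a u] [/= ai /IH ui ->]]].
have /andP[ng _] := alpha_mono wfp initp ai; case E: (alpha p a.2) ng => [//|f ts] ng.
apply: enumD_mono (tdepth_plug_gt _ ng) _ _; rewrite /= mem_cat; apply/orP; right.
by apply/allpairsP; exists (a, u); rewrite /= E.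
Qed.

(** [j] counts the letters that are not variables: each of them pushes all variables at least one
    level down and adds at most [M] to the depth. So one variable at a small depth bounds the depth
    of the whole value. *)
Lemma enumD_deep M k v : {in plets p, forall a, (tdepth a.2 <= M)%N} -> v \in enumD k ->
  exists2 j, deep j v & (tdepth v <= j * M)%N.
Proof.
move=> hM; elim: k v => [|k IH] v; first by case/mapP=> z _ ->; exists 0%N.
rewrite /= mem_cat => /orP[/IH //|/allpairsP[[a u] [/= ai /IH[j dj hj] ->]]].
case E: (alpha p a.2) => [x|f ts]; first by exists j.
exists j.+1; first exact: deep_plugS.
apply: leq_trans (tdepth_plug_le _ _) _; rewrite mulSn leq_add // -E.
exact: leq_trans (tdepth_alpha wfp a.2) (hM _ ai).
Qed.

Lemma size_enumD k : size (enumD k) = (m * (size (plets p)).+1 ^ k)%N.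
Proof.
elim: k => [|k IH]; first by rewrite size_map size_iota muln1.
by rewrite /= size_cat size_allpairs IH expnS [RHS]mulnCA mulSn.
Qed.

Definition good_word (s : state F) : Prop :=
  forall z, (z < m)%N -> exists k, s z \in enumD k.

Lemma good_word_aexec a s : a \in plets p -> good_word s -> good_word (aexec p a s).
Proof.
move=> ai gs z zm; rewrite /aexec /exec /upd; case: eqP => [_|_] /=; last exact: gs.
rewrite aexec_plug //; have [k hk] := gs _ (aletter_lt ai).
exists k.+1; rewrite /= mem_cat; apply/orP; right.
by apply/allpairsP; exists (a, s (mvar (alpha p a.2))).
Qed.

Lemma good_word0 : good_word (@Var F).
Proof. by move=> z zm; exists 0%N; apply/mapP; exists z; rewrite ?mem_iota. Qed.

Lemma arun_good w : all (mem (plets p)) w ->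
  [/\ good_word (arun p w), good_num (arun p w) & forall z, (n <= z)%N -> arun p w z = Var F z].
Proof.
move=> ww; split.
- elim/last_ind: w ww => [_|w a IH]; first exact: good_word0.
  rewrite all_rcons => /andP[ai /IH g]; rewrite /arun /runs -cats1 foldl_cat.
  exact: good_word_aexec.
- elim/last_ind: w ww => [_ z|w a IH]; first exact: mono_Var.
  rewrite all_rcons => /andP[ai /IH g]; rewrite /arun /runs -cats1 foldl_cat.
  exact: good_num_aexec.
move=> z zn; have [_ h <-] := arun_spec wfp initp ww.
by rewrite h // (alpha_Var wfp).
Qed.

(** * Equalities that mix a program variable with initial values *)

Section Indicator.
Variable H : nat.

Definition small : seq (term F) := [seq v <- enumD H | (tdepth v <= H)%N].

Lemma smallP k v : v \in enumD k -> (tdepth v <= H)%N -> v \in small.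
Proof.
by move=> /enumD_depth vd h; rewrite mem_filter h; apply: enumD_mono h _ vd.
Qed.

Definition ind_feature (s : state F) (j : option ('I_m * seq_sub small)) : K :=
  if j is Some zg then (s zg.1 == val zg.2)%:R else 1.

Definition ind_coef (a : letter F) (i j : option ('I_m * seq_sub small)) : K :=
  if j is Some zg then
    if zg.1 == a.1 :> nat then
      if i is Some yg then
        ((yg.1 == mvar (alpha p a.2) :> nat) && (plug (alpha p a.2) (val yg.2) == val zg.2))%:R
      else 0
    else (i == j)%:R
  else (i == j)%:R.

(** If the value after an assignment is a small term, so is the value it was made from, since
    plugging into a term with a variable never lowers the depth. Hence the indicators of small
    values are closed under assignments. *)
Lemma ind_feature_aexec a s j : a \in plets p -> good_word s ->
  ind_feature (aexec p a s) j = \sum_i ind_feature s i * ind_coef a i j.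
Proof.
move=> ai gs; case: j => [[z g]|] /=; last by rewrite -[LHS](sum_delta1 (ind_feature s) None).
rewrite /aexec /exec /upd /=; case: (@eqP _ (nat_of_ord z) a.1) => [ez|_];
  last by rewrite -[LHS](sum_delta1 (ind_feature s) (Some (z, g))).
rewrite aexec_plug //; set t := alpha p a.2; set y := mvar t.
have [e|ne] := eqVneq (plug t (s y)) (val g); last first.
  rewrite big1 // => -[[y' g']|] _ /=; last by rewrite mulr0.
  have [e1|_] := eqVneq (s y') (val g'); last by rewrite mul0r.
  have [e2|_] /= := eqVneq (y' : nat) y; last by rewrite mulr0.
  by rewrite -e1 e2 (negPf ne) mulr0.
have [k hk] := gs y (aletter_lt ai).
have sy : s y \in small.
  apply: smallP hk _; have := valP g; rewrite mem_filter -e => /andP[h _].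
  apply: leq_trans (tdepth_subst_ge _ _) h; apply: mvar_in.
  by case/andP: (alpha_mono wfp initp ai).
rewrite (bigD1 (Some (Ordinal (aletter_lt ai), SeqSub sy))) //= eqxx /=.
rewrite [plug _ _ == _](_ : _ = true) ?mul1r; last by apply/eqP.
rewrite eqxx big1 ?addr0 // => -[[y' g']|] /= ne; last by rewrite mulr0.
have [e1|_] := eqVneq (s y') (val g'); last by rewrite mul0r.
have [e2|_] /= := eqVneq (y' : nat) y; last by rewrite mulr0.
case/eqP: ne; congr (Some (_, _)); apply: val_inj => //=.
by rewrite -e1 e2.
Qed.

Lemma ind_bound N i (l : option ('I_m * seq_sub small) -> K) :
  (size indices * (m * size (enumD H)).+1 ^ 2 <= N)%N ->
  (forall w, (i, w) \in db p N -> \sum_j ind_feature (arun p w) j * l j = 0) ->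
  forall k w, (i, w) \in db p k -> \sum_j ind_feature (arun p w) j * l j = 0.
Proof.
move=> Nge; apply: (db_transfer good_word_aexec ind_feature_aexec); first exact: good_word0.
apply: leq_trans Nge; rewrite card_option card_prod card_ord leq_mul2l leq_exp2r //.
rewrite ltnS leq_mul2l; apply/orP; right; apply/orP; right.
rewrite cardE -(size_map val); apply: uniq_leq_size.
  by rewrite map_inj_uniq ?enum_uniq //; exact: val_inj.
by move=> _ /mapP[g _ ->]; have := valP g; rewrite mem_filter => /andP[].
Qed.

(** The indicators for [y] sum to 1 exactly if the value of [y] is small, so smallness is a linear
    relation and can be transferred. *)
Lemma ind_total s (y : 'I_m) :
  \sum_j ind_feature s j * (if j is Some zg then (zg.1 == y)%:R else -1) =
  (s y \in small)%:R - 1.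
Proof.
rewrite (bigD1 None) //= mul1r addrC; congr (_ - _).
have [sy|sy] := boolP (s y \in small); last first.
  apply: big1 => -[[z g]|] //= _; have [->|_] := eqVneq z y; last by rewrite mulr0.
  have [e|_] := eqVneq (s y) (val g); last by rewrite mul0r.
  by case/negP: sy; rewrite e; exact: valP.
rewrite (bigD1 (Some (y, SeqSub sy))) //= !eqxx mul1r big1 ?addr0 //.
case=> [[z g]|] //= ne; have [ez|_] := eqVneq z y; last by rewrite mulr0.
have [e|_] := eqVneq (s z) (val g); last by rewrite mul0r.
by case/eqP: ne; congr (Some (_, _)) => //; apply: val_inj; rewrite /= -e ez.
Qed.

Lemma subst_inj_in r1 r2 (t : term F) : subst r1 t = subst r2 t -> {in vars t, r1 =1 r2}.
Proof.
elim/term_indS: t => [x|f ts IH].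
  by move=> /= e z; rewrite inE => /eqP->.
move=> [/eq_in_map e] z /vars_App[t ti zt]; exact: IH ti (e _ ti) _ zt.
Qed.

(* The initial value [c] occurs in [t[y]] at a depth bounded by that of [t], and
   each letter of [x] adds to its depth; so [x] and [y] have finitely many
   values. *)
Lemma mixed_bound N M i (x y c : 'I_m) (t : term F) :
  (size indices * (m * size (enumD H)).+1 ^ 2 <= N)%N ->
  {in plets p, forall a, (tdepth a.2 <= M)%N} -> (tdepth t * M <= H)%N ->
  (y : nat) \in vars t -> (c : nat) \in vars t -> (n <= c)%N ->
  (forall z, z \in vars t -> z = y \/ (n <= z)%N) ->
  (forall w, (i, w) \in db p N -> arun p w x = subst (arun p w) t) ->
  forall k w, (i, w) \in db p k -> arun p w x = subst (arun p w) t.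
Proof.
move=> Nge hM tM yt ct nc vt HN.
pose th h := subst (upd (@Var F) y h) t.
have thE k w : (i, w) \in db p k -> subst (arun p w) t = th (arun p w y).
  move=> /(db_plets wfp)/arun_good[_ _ out]; apply: eq_subst_in => z /vt; rewrite /upd.
  by case: eqP => [->//|_ [//|/out]].
have inN w : (i, w) \in db p N -> arun p w x \in small /\ arun p w y \in small.
  move=> wd; have [gw _ out] := arun_good (db_plets wfp wd).
  have [kx hx] := gw x (ltn_ord x); have [ky hy] := gw y (ltn_ord y).
  have [j dj lj] := enumD_deep hM hx.
  have le : (tdepth (arun p w x) <= H)%N.
    apply: leq_trans lj (leq_trans _ tM); rewrite leq_mul2r; apply/orP; right.
    by apply: deep_le ct (out _ nc); rewrite -HN.
  split; first exact: smallP hx le.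
  apply: smallP hy (leq_trans _ le); rewrite HN //; exact: tdepth_subst_ge.
move=> k w wd.
(* Smallness of [y] is a linear relation that holds at depth [N], hence it holds for [w] as well. *)
have ysm : arun p w y \in small.
  have := ind_bound Nge (i := i) (l := fun j => if j is Some zg then (zg.1 == y)%:R else -1) _ wd.
  rewrite ind_total => /(_ _)/eqP; case: (_ \in _) => //; rewrite sub0r oppr_eq0 oner_eq0; apply.
  by move=> w' /inN[_ h]; rewrite ind_total h subrr.
(* The relation [[y = h] = [x = th h]] between indicators. If [th h] is not small it has no
   coordinate, and the second indicator is replaced by 0. *)
pose l h (j : option ('I_m * seq_sub small)) : K :=
  (j == Some (y, h))%:R - (if insub (th (val h)) is Some g then (j == Some (x, g))%:R else 0).
have lE s h : \sum_j ind_feature s j * l h j =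
    (s y == val h)%:R - ((s x == th (val h)) && (s x \in small))%:R.
  rewrite /l; under eq_bigr => j _ do rewrite mulrBr.
  rewrite sumrB sum_delta1 /=; congr (_ - _).
  case: insubP => [g gs eg|ns].
    rewrite sum_delta1 /= -eg; case: eqP => // ->; by rewrite (valP g).
  rewrite big1 => [|j _]; last by rewrite mulr0.
  by case: eqP => // ->; rewrite (negPf ns).
rewrite (thE _ _ wd); have [//|ne] := eqVneq (arun p w x) (th (arun p w y)).
suff /eqP : (1 : K) = 0 by rewrite oner_eq0.
have := ind_bound Nge (i := i) (l := l (SeqSub ysm)) _ wd.
rewrite lE /= eqxx (negPf ne) subr0; apply=> w' wd'; rewrite lE /=.
have [xs ys] := inN w' wd'; rewrite xs andbT HN // (thE _ _ wd').
(* [th] is injective because [y] occurs in [t]. *)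
have -> : (th (arun p w' y) == th (arun p w y)) = (arun p w' y == arun p w y).
  apply/eqP/eqP => [|->//] /subst_inj_in/(_ _ yt); by rewrite /upd eqxx.
by rewrite subrr.
Qed.
End Indicator.

(** If [alpha p t] has exactly one variable, the affine relations apply. Otherwise it contains a
    program variable: runs would leave it unchanged if it did not, and it would equal the
    one-variable value of [x] after some word. Having a further variable, which denotes an element
    of R, it falls under [mixed_bound]. *)
Lemma leaf_bound N M H i x (t : term F) :
  (size indices * m.+1 ^ 2 <= N)%N ->
  (size indices * (m * size (enumD H)).+1 ^ 2 <= N)%N ->
  {in plets p, forall a, (tdepth a.2 <= M)%N} -> (tdepth t * M <= H)%N ->
  (x < n)%N -> all (fun z => z < n)%N (vars t) -> at_most_one_var t ->
  (forall w, (i, w) \in db p N -> wp w (Var F x) = wp w t) ->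
  forall k w, (i, w) \in db p k -> wp w (Var F x) = wp w t.
Proof.
move=> N1 N2 hM tM xn vt /at_most_one_varP[y0 ty] HN k w wd.
have vx : all (fun z => z < n)%N (vars (Var F x)) by rewrite /= xn.
apply/(arun_eq wfp initp (db_plets wfp wd) vx vt); rewrite (alpha_Var wfp).
have {}HN w' : (i, w') \in db p N -> arun p w' x = subst (arun p w') (alpha p t).
  move=> wd'; have /(arun_eq wfp initp (db_plets wfp wd') vx vt) := HN w' wd'.
  by rewrite (alpha_Var wfp).
have xm : (x < m)%N by apply: leq_trans xn _; rewrite /m !addSn ltnW // ltnW // leq_addr.
have lt_m z : z \in vars (alpha p t) -> (z < m)%N.
  case/(alpha_vars wfp) => [/(allP vt) zn|/andP[_ h]]; last exact: h.
  by apply: leq_trans zn _; rewrite /m !addSn ltnW // ltnW // leq_addr.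
have [mt|nmt] := boolP (mono (alpha p t)).
  have ym : (mvar (alpha p t) < m)%N by apply: lt_m; apply: mvar_in; case/andP: mt.
  have numE k' w' : (i, w') \in db p k' -> num (subst (arun p w') (alpha p t)) =
      num_shift (alpha p t) + num_scale (alpha p t) * num (arun p w' (mvar (alpha p t))).
    move=> /(db_plets wfp)/arun_good[_ g _]; rewrite subst_plug // num_plug //.
  have [_ g _] := arun_good (db_plets wfp wd).
  apply: num_inj; [exact: g|by rewrite subst_plug // mono_plug|].
  rewrite (numE _ _ wd); apply: (@num_bound N i (Ordinal xm) (Ordinal ym) _ _ N1 _ _ _ wd).
  by move=> w' wd' /=; rewrite HN // (numE _ _ wd').
have [e|/allPn[[i' w1] wd1 /negPn/eqP/= e]] := boolP (all (fun it => it.1 != i) (db p N)).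
  suff : (i, w) \notin db p k by rewrite wd.
  apply: (empty_bound N1) => w'; apply/negP => wd'.
  by have := allP e _ wd'; rewrite eqxx.
rewrite {i'}e in wd1; have [_ g out] := arun_good (db_plets wfp wd1).
have mo : mono (subst (arun p w1) (alpha p t)) by rewrite -HN.
have [/hasP[y yv yn]|nh] := boolP (has (fun z => z < n)%N (vars (alpha p t))); last first.
  case/negP: nmt; rewrite -(@subst_Var_in _ (arun p w1) (alpha p t)) // => z zi.
  by apply: out; rewrite leqNgt; apply: contra nh => zn; apply/hasP; exists z.
have yt : y \in vars t.
  by case: (alpha_vars wfp yv) => // /andP[/ltnW/ltnW]; rewrite leqNgt yn.
have ey : y0 = y by have := ty _ yt; rewrite inE => /eqP.
have [c ct cn] : exists2 c, c \in vars (alpha p t) & (n <= c)%N.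
  have [/hasP[c cv cn]|nh] := boolP (has (fun z => n <= z)%N (vars (alpha p t))); first by exists c.
  case/negP: nmt; apply/monoP; exists y => // z zi.
  have zn : (z < n)%N by rewrite ltnNge; apply: contra nh => ?; apply/hasP; exists z.
  by case: (alpha_vars wfp zi) => [/ty|/andP[/ltnW/ltnW]]; rewrite ?ey // leqNgt zn.
have := @mixed_bound H N M i (Ordinal xm) (Ordinal (lt_m _ yv)) (Ordinal (lt_m _ ct)) (alpha p t) N2 hM.
move=> /(_ _ yv ct cn _ HN k w wd) /=; apply.
- by apply: leq_trans tM; rewrite leq_mul2r (tdepth_alpha wfp) orbT.
- move=> z /(alpha_vars wfp)[/ty|/andP[h _]]; first by rewrite inE ey => /eqP; left.
  by right; apply: ltnW; apply: ltnW.
Qed.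

Lemma wp_App w f (ts : seq (term F)) : wp w (App f ts) = App f (map (wp w) ts).
Proof.
elim: w => [|a w IH] /=; first by rewrite map_id.
by rewrite IH /subst1 /= -map_comp.
Qed.

(** Both sides are decomposed in parallel until one of them is a variable. Agreement of the head
    symbols is observed on a word of depth at most [N]; if there is none, there are no words at
    all. *)
Lemma eq_bound N M H i (s t : term F) :
  (size indices * m.+1 ^ 2 <= N)%N ->
  (size indices * (m * size (enumD H)).+1 ^ 2 <= N)%N ->
  {in plets p, forall a, (tdepth a.2 <= M)%N} ->
  (tdepth s * M <= H)%N -> (tdepth t * M <= H)%N ->
  all (fun z => z < n)%N (vars s) -> all (fun z => z < n)%N (vars t) ->
  at_most_one_var s -> at_most_one_var t ->
  (forall w, (i, w) \in db p N -> wp w s = wp w t) ->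
  forall k w, (i, w) \in db p k -> wp w s = wp w t.
Proof.
move=> N1 N2 hM.
have arg f (ts : seq (term F)) u : u \in ts -> (tdepth (App f ts) * M <= H)%N ->
    all (fun z => z < n)%N (vars (App f ts)) -> at_most_one_var (App f ts) ->
    [/\ (tdepth u * M <= H)%N, all (fun z => z < n)%N (vars u) & at_most_one_var u].
  move=> ui h v /at_most_one_varP[x sx]; split.
  - by apply: leq_trans h; rewrite leq_mul2r ltnW ?orbT //; apply: tdepth_arg ui.
  - by apply/allP => z zu; apply: (allP v); apply: in_vars_App ui zu.
  - by apply/at_most_one_varP; exists x => z zu; apply: sx; apply: in_vars_App ui zu.
elim/term_indS: s t => [x|f ss IH] t hs ht vs vt as_ at_ HN.
  by apply: (leaf_bound N1 N2 hM ht) => //; have := vs; rewrite /= andbT.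
case: t ht vt at_ HN => [y|g ts] ht vt at_ HN.
  move=> k w wd; apply/esym; apply: (leaf_bound N1 N2 hM hs _ vs as_) wd.
    by have := vt; rewrite /= andbT.
  by move=> w' /HN.
move=> k w wd.
have [e|/allPn[[i' w1] wd1 /negPn/eqP/= e]] := boolP (all (fun it => it.1 != i) (db p N)).
  suff : (i, w) \notin db p k by rewrite wd.
  apply: (empty_bound N1) => w'; apply/negP => wd'.
  by have := allP e _ wd'; rewrite eqxx.
rewrite {i'}e in wd1; rewrite !wp_App.
have HN' w' : (i, w') \in db p N -> f = g /\ map (wp w') ss = map (wp w') ts.
  by move=> /HN; rewrite !wp_App => -[].
have [<- _] := HN' _ wd1; congr App.
have {}HN w' : (i, w') \in db p N -> map (wp w') ss = map (wp w') ts by case/HN'.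
have argS u ui := arg f ss u ui hs vs as_; have argT u ui := arg g ts u ui ht vt at_.
clear HN' hs vs as_ ht vt at_.
elim: ss ts IH HN argS argT => [|s ss IHs] [|t ts] IH HN argS argT //; first by have := HN _ wd1.
  by have := HN _ wd1.
have [s1 s2 s3] := argS s (mem_head _ _); have [t1 t2 t3] := argT t (mem_head _ _).
rewrite /=; congr cons.
  by apply: (IH s (mem_head _ _) t) wd => // w' /HN [].
apply: IHs => [u ui|w' /HN[_ ->//]|u ui|u ui].
- by apply: IH; rewrite inE ui orbT.
- by apply: argS; rewrite inE ui orbT.
- by apply: argT; rewrite inE ui orbT.
Qed.

End Bound.

(** * An explicit bound *)

Fixpoint tree_size (b : btree) : nat :=
  match b with Leaf => 1 | Node a b => (tree_size a + tree_size b).+1 end.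

Lemma tree_size_nat n : n <= tree_size (code_nat n).
Proof. by elim: n => // n IH /=; lia. Qed.

Section CodeSeq.
Variables (T : eqType) (code : T -> btree).

Lemma tree_size_mem (l : seq T) x : x \in l -> tree_size (code x) <= tree_size (code_seq code l).
Proof.
elim: l => //= y l IH; rewrite inE => /orP[/eqP->|/IH h]; apply: leqW.
  exact: leq_addr.
exact: leq_trans h (leq_addl _ _).
Qed.
End CodeSeq.

Lemma tree_size_sumn (T : Type) (code : T -> btree) (f : T -> nat) (l : seq T) :
  (forall x, f x <= tree_size (code x)) -> sumn (map f l) <= tree_size (code_seq code l).
Proof. by move=> h; elim: l => //= x l IH; have := h x; lia. Qed.

Lemma tree_size_seq (T : Type) (code : T -> btree) (l : seq T) :
  size l <= tree_size (code_seq code l).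
Proof. by elim: l => //= x l IH; lia. Qed.

Lemma tree_size_nth (T : Type) (code : T -> btree) x0 (l : seq T) q : q < size l ->
  tree_size (code (nth x0 l q)) <= tree_size (code_seq code l).
Proof. by elim: l q => //= x l IH [|q] /=; [lia | move=> /IH; lia]. Qed.

Lemma tree_size_term (F : countType) (t : term F) : tdepth t <= tree_size (code_term t).
Proof.
elim/term_indS: t => // f ts IH.
have /(@tdepth_App_le _ f) : {in ts, forall t, tdepth t <= tree_size (code_seq (@code_term F) ts)}.
  by move=> t ti; apply: leq_trans (IH t ti) (tree_size_mem _ ti).
move/leq_trans; apply.
change (code_term (App f ts)) with
  (Node (code_nat 1) (Node (code_nat (pickle f)) (code_seq (@code_term F) ts))).
by move: (code_seq _ ts) (code_nat (pickle f)) => b c /=; lia.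
Qed.

(** A crude closed form. For an input of size [T], the numbers of nodes and of letters are at most
    [2T], so with [S = 4(T+1)] the number of indicators stays below [S^(H+2)] for [H = T^2]. The
    required depth is at most [S] times the square of this, with exponent [2H+5], and [square_bound]
    puts that exponent below [S^2]. *)
Definition rounds (b : btree) : nat := let S := 4 * (tree_size b).+1 in S ^ (S * S).

Lemma square_bound T : ((T * T).+2 * 2).+1 <= 4 * T.+1 * (4 * T.+1).
Proof. by lia. Qed.

Lemma power_bound m P S H : m < S -> P <= S -> m * (m * P ^ H) < S ^ H.+2.
Proof.
move=> mS PS; have PH : P ^ H <= S ^ H by case: H => // H; rewrite leq_exp2r.
apply: (@leq_ltn_trans (m * (S * S ^ H))); first by rewrite leq_mul2l leq_mul ?orbT // ltnW.
rewrite (expnS S H.+1) (expnS S H) ltn_mul2r mS andbT -expnS expn_gt0.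
by rewrite (leq_ltn_trans _ mS).
Qed.

Section Rounds.
Variables (F : countType) (ar : F -> nat) (p : program F) (b : btree).
Hypotheses (wfp : wf_program ar p) (sub : tree_size (code_program p) <= tree_size b).
Let T := tree_size b.

Lemma proc_sum (f : procedure F -> nat) : (forall pr, f pr <= tree_size (code_procedure pr)) ->
  sumn [seq f (getp p q) | q <- iota 0 (size (procs p))] <= T.
Proof.
move=> h; rewrite (_ : map _ _ = map f (procs p)).
  by have := tree_size_sumn (procs p) h; move: sub; rewrite /= -/T; lia.
by rewrite -[procs p in RHS](mkseq_nth (Procedure 0 0 0 [::])) -map_comp.
Qed.

Lemma edges_sum : size (alledges p) <= T.
Proof.
rewrite size_flatten /shape -map_comp (eq_map (g := fun q => size (edges (getp p q)))); last first.
  by move=> q /=; rewrite size_map.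
apply: (@proc_sum (fun pr => size (edges pr))) => pr.
by have := tree_size_seq (@code_edge F) (edges pr); rewrite /=; lia.
Qed.

Lemma indices_sum : size (indices p) <= 2 * T.
Proof.
rewrite size_cat !size_map addnn -mul2n leq_mul2l /= size_flatten /shape -map_comp.
rewrite (eq_map (g := fun q => npoints (getp p q))); last by move=> q /=; rewrite size_map size_iota.
apply: (@proc_sum (@npoints F)) => pr.
by have := tree_size_nat (npoints pr); rewrite /=; lia.
Qed.

Lemma plets_sum : size (plets p) <= 2 * T.
Proof.
apply: leq_trans (_ : 2 * size (alledges p) <= _); last by rewrite leq_mul2l edges_sum orbT.
rewrite /plets; elim: (alledges p) => //= e l IH; rewrite size_cat mulnS leq_add //.
by case: e.2.1.2.
Qed.

Lemma plets_depth : {in plets p, forall a, tdepth a.2 <= T}.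
Proof.
move=> a /flatten_mapP[[q [[u l] v]] /(edgeP wfp)/(wf_edge wfp)[/= hq _ _ _ ei]].
case: l ei => [x t|x|r] ei; rewrite ?inE; last by [].
  move=> /eqP-> /=; apply: leq_trans (tree_size_term t) (leq_trans _ sub).
  have h1 := tree_size_mem (@code_edge F) ei.
  have h2 : tree_size (code_procedure (getp p q)) <= tree_size (code_seq (@code_procedure F) (procs p)).
    exact: tree_size_nth.
  by rewrite /= in h1 h2 *; lia.
by case/orP=> /eqP->.
Qed.

Lemma rounds_enough H : H = T * T -> nvars p <= T ->
  let m := (nvars p).+2 + size (inits p) in
  size (indices p) * m.+1 ^ 2 <= rounds b /\
  size (indices p) * (m * size (enumD p H)).+1 ^ 2 <= rounds b.
Proof.
move=> eH hn m; rewrite size_enumD -/m /rounds -/T; set S := 4 * T.+1.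
have hi : size (inits p) <= 2 * T.
  by rewrite size_map; apply: leq_trans plets_sum; rewrite size_filter count_size.
have mS : m < S by rewrite /m /S; lia.
have iS : size (indices p) <= S by apply: leq_trans indices_sum _; rewrite /S; lia.
have pS : (size (plets p)).+1 <= S by have := plets_sum; rewrite /S; lia.
have S0 : 0 < S by [].
have e1 : S * S ^ 2 <= S ^ (S * S).
  by rewrite -expnS leq_pexp2l // (@leq_trans (4 * 4)) // leq_mul // leq_pmulr.
split; first by apply: leq_trans e1; rewrite leq_mul // leq_exp2r.
have e2 := power_bound H mS pS.
have e3 : S * (S ^ H.+2) ^ 2 <= S ^ (S * S).
  by rewrite -expnM -expnS leq_pexp2l // eH square_bound.
by apply: leq_trans e3; rewrite leq_mul // leq_exp2r.
Qed.
End Rounds.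

(** * Computable functions *)

Definition tcomp (g : btree -> btree) : Prop := exists r, forall x, computes r x (g x).

Definition bleft (b : btree) : btree := if b is Node a _ then a else Leaf.
Definition bright (b : btree) : btree := if b is Node _ c then c else Leaf.

Fixpoint brec (f g : btree -> btree) (p x : btree) : btree :=
  match x with
  | Leaf => f p
  | Node a b => g (Node p (Node (Node a b) (Node (brec f g p a) (brec f g p b))))
  end.

Lemma tc_id : tcomp (fun x => x).
Proof. by exists RId; constructor. Qed.

Lemma tc_leaf : tcomp (fun _ => Leaf).
Proof. by exists RLeaf; constructor. Qed.

Lemma tc_left f : tcomp f -> tcomp (fun x => bleft (f x)).
Proof.
case=> r h; exists (RComp RLeft r) => x; apply: computes_comp (h x) _.
by case: (f x); constructor.
Qed.

Lemma tc_right f : tcomp f -> tcomp (fun x => bright (f x)).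
Proof.
case=> r h; exists (RComp RRight r) => x; apply: computes_comp (h x) _.
by case: (f x); constructor.
Qed.

Lemma tc_node f g : tcomp f -> tcomp g -> tcomp (fun x => Node (f x) (g x)).
Proof. by case=> r h [r' h']; exists (RPair r r') => x; constructor. Qed.

Lemma tc_comp f g : tcomp f -> tcomp g -> tcomp (fun x => f (g x)).
Proof. by case=> r h [r' h']; exists (RComp r r') => x; apply: computes_comp (h' x) (h _). Qed.

Lemma tc_const b : tcomp (fun _ => b).
Proof. by elim: b => [|a IHa b IHb]; [exact: tc_leaf|exact: tc_node]. Qed.

Lemma tc_if c f g : tcomp c -> tcomp f -> tcomp g ->
  tcomp (fun x => if c x is Node _ _ then f x else g x).
Proof.
case=> r h [r1 h1] [r2 h2]; exists (RIf r r1 r2) => x; have := h x.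
case: (c x) => [|a b] hx; first exact: computes_if_false hx (h2 x).
exact: computes_if_true hx (h1 x).
Qed.

Lemma tc_rec f g p x : tcomp f -> tcomp g -> tcomp p -> tcomp x ->
  tcomp (fun y => brec f g (p y) (x y)).
Proof.
case=> r h [r1 h1] [r2 h2] [r3 h3]; exists (RComp (RRec r r1) (RPair r2 r3)) => y.
apply: computes_comp (computes_pair (h2 y) (h3 y)) _.
elim: (x y) => [|a IHa b IHb] /=; first exact: computes_rec_leaf.
exact: computes_rec_node IHa IHb (h1 _).
Qed.

(** * Computability on coded types *)

Class coded (T : Type) := enc : T -> btree.

#[export] Instance coded_btree : coded btree := id.
#[export] Instance coded_bool : coded bool := code_bool.
#[export] Instance coded_nat : coded nat := code_nat.
#[export] Instance coded_prod A B `{coded A} `{coded B} : coded (A * B) :=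
  fun x => Node (enc x.1) (enc x.2).
#[export] Instance coded_seq A `{coded A} : coded (seq A) := code_seq enc.

Definition computable {A B : Type} `{coded A} `{coded B} (f : A -> B) : Prop :=
  exists2 g, tcomp g & forall a, g (enc a) = enc (f a).

Lemma computable_recfun A B `{coded A} `{coded B} (f : A -> B) :
  computable f -> exists r, forall a, computes r (enc a) (enc (f a)).
Proof. by case=> g [r h] e; exists r => a; rewrite -e. Qed.

Section Closure.
Context {G A B C D : Type} {cG : coded G} {cA : coded A} {cB : coded B} {cC : coded C} {cD : coded D}.

Lemma c_id : computable (fun x : G => x).
Proof. by exists id; first exact: tc_id. Qed.

Lemma c_const (b : B) : computable (fun _ : G => b).
Proof. by exists (fun=> enc b); first exact: tc_const. Qed.

Lemma c_app (f : A -> B) (g : G -> A) :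
  computable f -> computable g -> computable (fun x => f (g x)).
Proof.
case=> f' tf ef [g' tg eg]; exists (fun x => f' (g' x)); first exact: tc_comp.
by move=> a; rewrite eg ef.
Qed.

Lemma c_ext (f g : G -> B) : f =1 g -> computable f -> computable g.
Proof. by move=> e [h th eh]; exists h => // a; rewrite eh e. Qed.

Lemma c_fst (f : G -> A * B) : computable f -> computable (fun x => (f x).1).
Proof. by case=> g tg eg; exists (fun x => bleft (g x)); [exact: tc_left|move=> a; rewrite eg]. Qed.

Lemma c_snd (f : G -> A * B) : computable f -> computable (fun x => (f x).2).
Proof. by case=> g tg eg; exists (fun x => bright (g x)); [exact: tc_right|move=> a; rewrite eg]. Qed.

Lemma c_pair (f : G -> A) (g : G -> B) :
  computable f -> computable g -> computable (fun x => (f x, g x)).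
Proof.
case=> f' tf ef [g' tg eg]; exists (fun x => Node (f' x) (g' x)); first exact: tc_node.
by move=> a; rewrite ef eg.
Qed.

Lemma c_if (b : G -> bool) (f g : G -> A) : computable b -> computable f -> computable g ->
  computable (fun x => if b x then f x else g x).
Proof.
case=> b' tb eb [f' tf ef] [g' tg eg].
exists (fun x => if b' x is Node _ _ then f' x else g' x); first exact: tc_if.
by move=> a; rewrite eb; case: (b a); [exact: ef|exact: eg].
Qed.

Lemma c_cons (f : G -> A) (g : G -> seq A) : computable f -> computable g ->
  computable (fun x => f x :: g x).
Proof.
case=> f' tf ef [g' tg eg]; exists (fun x => Node (f' x) (g' x)); first exact: tc_node.
by move=> a; rewrite ef eg.
Qed.

Lemma c_succ (f : G -> nat) : computable f -> computable (fun x => (f x).+1).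
Proof.
case=> f' tf ef; exists (fun x => Node Leaf (f' x)).
  exact: tc_node tc_leaf tf.
by move=> a; rewrite ef.
Qed.

Lemma c_foldr (f : G -> A -> B -> B) (z : G -> B) (l : G -> seq A) :
  computable (fun x : G * (A * B) => f x.1 x.2.1 x.2.2) -> computable z -> computable l ->
  computable (fun x => foldr (f x) (z x) (l x)).
Proof.
case=> f' tf ef [z' tz ez] [l' tl el].
exists (fun x => brec z' (fun y => f' (Node (bleft y)
   (Node (bleft (bleft (bright y))) (bright (bright (bright y)))))) x (l' x)).
  apply: tc_rec => //; last exact: tc_id.
  by apply: tc_comp tf _; do ![apply: tc_node|apply: tc_left|apply: tc_right|apply: tc_id].
move=> a; rewrite el; set R := brec _ _ _; elim: (l a) => [|x s IH]; first exact: ez.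
have -> : R (enc (x :: s)) = f' (Node (enc a) (Node (enc x) (R (enc s)))) by [].
rewrite IH.
exact: (ef (a, (x, foldr (f a) (z a) s))).
Qed.

Lemma c_lcase (z : G -> B) (f : G -> A -> seq A -> B) (l : G -> seq A) :
  computable z -> computable (fun x : G * (A * seq A) => f x.1 x.2.1 x.2.2) -> computable l ->
  computable (fun x => if l x is y :: s then f x y s else z x).
Proof.
case=> z' tz ez [f' tf ef] [l' tl el].
exists (fun x => if l' x is Node _ _ then f' (Node x (l' x)) else z' x).
  by apply: tc_if => //; apply: tc_comp tf _; apply: tc_node tc_id tl.
move=> a; rewrite el; case: (l a) => [|y s]; first exact: ez.
exact: (ef (a, (y, s))).
Qed.

Lemma c_iter (f : G -> B -> B) (z : G -> B) (n : G -> nat) :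
  computable (fun x : G * B => f x.1 x.2) -> computable z -> computable n ->
  computable (fun x => iter (n x) (f x) (z x)).
Proof.
case=> f' tf ef [z' tz ez] [n' tn en].
exists (fun x => brec z' (fun y => f' (Node (bleft y) (bright (bright (bright y))))) x (n' x)).
  apply: tc_rec => //; last exact: tc_id.
  by apply: tc_comp tf _; do ![apply: tc_node|apply: tc_left|apply: tc_right|apply: tc_id].
move=> a; rewrite en; set R := brec _ _ _; elim: (n a) => [|m IH]; first exact: ez.
have -> : R (enc m.+1) = f' (Node (enc a) (R (enc m))) by [].
rewrite IH.
exact: (ef (a, iter m (f a) (z a))).
Qed.

Fixpoint bfold (z : B) (f : B -> B -> B) (b : btree) : B :=
  match b with Leaf => z | Node a c => f (bfold z f a) (bfold z f c) end.

Lemma c_bfold (z : G -> B) (f : G -> B -> B -> B) (b : G -> btree) :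
  computable z -> computable (fun x : G * (B * B) => f x.1 x.2.1 x.2.2) -> computable b ->
  computable (fun x => bfold (z x) (f x) (b x)).
Proof.
case=> z' tz ez [f' tf ef] [b' tb eb].
exists (fun x => brec z' (fun y => f' (Node (bleft y) (bright (bright y)))) x (b' x)).
  apply: tc_rec => //; last exact: tc_id.
  by apply: tc_comp tf _; do ![apply: tc_node|apply: tc_left|apply: tc_right|apply: tc_id].
move=> a; rewrite eb -[enc (b a)]/(b a); set R := brec _ _ _;
elim: (b a) => [|x IHx y IHy]; first exact: ez.
have -> : R (Node x y) = f' (Node (enc a) (Node (R x) (R y))) by [].
rewrite IHx IHy.
exact: (ef (a, (bfold (z a) (f a) x, bfold (z a) (f a) y))).
Qed.

Lemma c_enc (f : G -> A) : computable f -> computable (fun x => enc (f x) : btree).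
Proof. by case=> g tg eg; exists g. Qed.
End Closure.

Lemma c_app2 (G A B D : Type) (cG : coded G) (cA : coded A) (cB : coded B) (cD : coded D)
  (f : G -> A -> B) (g : D -> G) (h : D -> A) :
  computable (fun x : G * A => f x.1 x.2) -> computable g -> computable h ->
  computable (fun x => f (g x) (h x)).
Proof.
move=> cf cg ch.
by apply: (c_app (f := fun x : G * A => f x.1 x.2) (g := fun x => (g x, h x))) => //; exact: c_pair.
Qed.

(** A hook for [c_step], redefined once the closure properties for lists and arithmetic are
    available. *)
Ltac c_known := fail.

Ltac c_step := cbv beta; lazymatch goal with
  | |- computable (fun _ => ?b) => apply (c_const b)
  | |- computable (fun x => x) => apply c_id
  | |- computable fst => apply (c_fst (f := fun x => x))
  | |- computable snd => apply (c_snd (f := fun x => x))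
  | |- computable (fun x => fst (@?f x)) => apply (c_fst (f := f))
  | |- computable (fun x => snd (@?f x)) => apply (c_snd (f := f))
  | |- computable (fun x => (@?f x, @?g x)) => apply (c_pair (f := f) (g := g))
  | |- computable (fun x => cons (@?f x) (@?g x)) => apply (c_cons (f := f) (g := g))
  | |- computable (fun x => S (@?f x)) => apply (c_succ (f := f))
  | |- computable (fun x => foldr (@?f x) (@?z x) (@?l x)) => apply (c_foldr (f := f) (z := z) (l := l))
  | |- computable (fun x => iter (@?n x) (@?f x) (@?z x)) => apply (c_iter (f := f) (z := z) (n := n))
  | |- computable (fun x => bfold (@?z x) (@?f x) (@?b x)) => apply (c_bfold (z := z) (f := f) (b := b))
  | |- _ => first
      [ assumption
      | match goal with
        | H : computable ?f |- computable (fun x => ?f (@?h x)) => apply (c_app (f := f) (g := h) H)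
        | H : computable (fun x => ?f (fst x) (snd x)) |- computable (fun x => ?f (@?g x) (@?h x)) =>
            apply (c_app2 (f := f) (g := g) (h := h) H)
        end
      | c_known | apply c_if | apply c_lcase ]
  end.
Ltac c_tac := repeat c_step.

Lemma c_behead (G A : Type) (cG : coded G) (cA : coded A) (f : G -> seq A) :
  computable f -> computable (fun x => behead (f x)).
Proof.
move=> cf; apply: (c_ext (f := fun x => if f x is _ :: s then s else [::])); last by c_tac.
by move=> x; case: (f x).
Qed.

Section Lists.
Context {G A B : Type} {cG : coded G} {cA : coded A} {cB : coded B}.

Lemma c_cat (f g : G -> seq A) : computable f -> computable g -> computable (fun x => f x ++ g x).
Proof.
move=> cf cg; apply: (c_ext (f := fun x => foldr (fun a s => a :: s) (g x) (f x))); last by c_tac.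
by move=> x; elim: (f x) => //= a s ->.
Qed.

Lemma c_map (f : G -> A -> B) (l : G -> seq A) :
  computable (fun x : G * A => f x.1 x.2) -> computable l ->
  computable (fun x => map (f x) (l x)).
Proof.
move=> cf cl; apply: (c_ext (f := fun x => foldr (fun a s => f x a :: s) [::] (l x))).
  by move=> x; elim: (l x) => //= a s ->.
by c_tac.
Qed.

Lemma c_filter (f : G -> pred A) (l : G -> seq A) :
  computable (fun x : G * A => f x.1 x.2) -> computable l ->
  computable (fun x => filter (f x) (l x)).
Proof.
move=> cf cl; apply: (c_ext (f := fun x => foldr (fun a s => if f x a then a :: s else s) [::] (l x))).
  by move=> x; elim: (l x) => //= a s ->.
by c_tac.
Qed.

Lemma c_all (f : G -> pred A) (l : G -> seq A) :
  computable (fun x : G * A => f x.1 x.2) -> computable l ->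
  computable (fun x => all (f x) (l x)).
Proof.
move=> cf cl; apply: (c_ext (f := fun x => foldr (fun a s => if f x a then s else false) true (l x))).
  by move=> x; elim: (l x) => //= a s ->.
by c_tac.
Qed.

Lemma c_nth (z : G -> A) (l : G -> seq A) (n : G -> nat) :
  computable z -> computable l -> computable n -> computable (fun x => nth (z x) (l x) (n x)).
Proof.
move=> cz cl cn.
apply: (c_ext (f := fun x => if iter (n x) behead (l x) is y :: _ then y else z x)).
  move=> x; rewrite -[in RHS](addn0 (n x)) -nth_drop nth0.
  by rewrite (_ : iter _ _ _ = drop (n x) (l x)); [case: (drop _ _)|rewrite drop_behead].
by c_tac; apply: c_behead; c_tac.
Qed.

Lemma c_rcons (f : G -> seq A) (g : G -> A) : computable f -> computable g ->
  computable (fun x => rcons (f x) (g x)).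
Proof.
move=> cf cg; apply: (c_ext (f := fun x => f x ++ [:: g x])); first by move=> x; rewrite cats1.
by apply: c_cat => //; c_tac.
Qed.

Lemma c_size (f : G -> seq A) : computable f -> computable (fun x => size (f x)).
Proof.
move=> cf; apply: (c_ext (f := fun x => foldr (fun _ n => n.+1) 0 (f x))); last by c_tac.
by move=> x; elim: (f x) => //= _ l ->.
Qed.
End Lists.

Lemma c_flatten (G A : Type) (cG : coded G) (cA : coded A) (l : G -> seq (seq A)) :
  computable l -> computable (fun x => flatten (l x)).
Proof. by move=> cl; rewrite /flatten; c_tac; apply: c_cat; c_tac. Qed.

Lemma c_add (G : Type) (cG : coded G) (f g : G -> nat) :
  computable f -> computable g -> computable (fun x => f x + g x).
Proof.
move=> cf cg; apply: (c_ext (f := fun x => iter (f x) succn (g x))); last by c_tac.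
by move=> x; rewrite iter_succn addnC.
Qed.

Lemma c_mul (G : Type) (cG : coded G) (f g : G -> nat) :
  computable f -> computable g -> computable (fun x => f x * g x).
Proof.
move=> cf cg; apply: (c_ext (f := fun x => iter (f x) (addn (g x)) 0)).
  by move=> x; rewrite iter_addn addn0 mulnC.
by c_tac; apply: c_add; c_tac.
Qed.

Lemma c_exp (G : Type) (cG : coded G) (f g : G -> nat) :
  computable f -> computable g -> computable (fun x => f x ^ g x).
Proof.
move=> cf cg; apply: (c_ext (f := fun x => iter (g x) (muln (f x)) 1)).
  by move=> x; rewrite iter_muln muln1.
by c_tac; apply: c_mul; c_tac.
Qed.

Lemma c_pred (G : Type) (cG : coded G) (f : G -> nat) :
  computable f -> computable (fun x => (f x).-1).
Proof.
case=> g tg eg; exists (fun x => bright (g x)); first exact: tc_right.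
by move=> a; rewrite eg; case: (f a).
Qed.

Lemma c_sub (G : Type) (cG : coded G) (f g : G -> nat) :
  computable f -> computable g -> computable (fun x => f x - g x).
Proof.
move=> cf cg; apply: (c_ext (f := fun x => iter (g x) predn (f x))).
  by move=> x; elim: (g x) (f x) => [|k IH] m /=; rewrite ?subn0 // IH subnS.
by c_tac; apply: c_pred; c_tac.
Qed.

Lemma c_iota (G : Type) (cG : coded G) (f g : G -> nat) :
  computable f -> computable g -> computable (fun x => iota (f x) (g x)).
Proof.
move=> cf cg.
apply: (c_ext (f := fun x => iter (g x) (fun s => rcons s (f x + size s)) [::])).
  move=> x; elim: (g x) => // k IH; rewrite iterS IH size_iota.
  by rewrite -addn1 iotaD cats1.
c_tac; apply: c_rcons; c_tac; apply: c_add; c_tac; apply: c_size; c_tac.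
Qed.

(* Equality is decided through an injective numbering of trees. *)
Definition tree_nat : btree -> nat := bfold 0 (fun a b => ((a + b) * (a + b) + a).+1).

(** [(a + b)^2 + a] lies strictly below the next square, so it determines [a + b] and then [a]. *)
Lemma square_pair_inj (a b c d : nat) :
  (a + b) * (a + b) + a = (c + d) * (c + d) + c -> a = c /\ b = d.
Proof.
move=> e; have es : a + b = c + d.
  case: (ltngtP (a + b) (c + d)) => // h; exfalso.
    have := leq_mul h h; rewrite mulSn mulnS; lia.
  have := leq_mul h h; rewrite mulSn mulnS; lia.
by move: e; rewrite es; lia.
Qed.

Lemma tree_nat_inj : injective tree_nat.
Proof.
elim=> [|a IHa b IHb] [|c d] //= [e].
by have [/IHa-> /IHb->] := square_pair_inj e.
Qed.

Class enc_inj (T : Type) {c : coded T} := encI : injective (@enc T c).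
Arguments enc_inj T {c}.

#[export] Instance enc_inj_bool : enc_inj bool. Proof. by case=> [] []. Qed.
#[export] Instance enc_inj_nat : enc_inj nat.
Proof. by elim=> [|m IH] [|n] //= [/IH->]. Qed.
#[export] Instance enc_inj_prod A B {cA : coded A} {cB : coded B} {iA : enc_inj A} {iB : enc_inj B} :
  enc_inj (A * B).
Proof. by move=> [a b] [c d] [e1 e2]; rewrite (iA _ _ e1) (iB _ _ e2). Qed.

Lemma c_eq (G : Type) (cG : coded G) (A : eqType) (cA : coded A) (iA : enc_inj A) (f g : G -> A) :
  computable f -> computable g -> computable (fun x => f x == g x).
Proof.
move=> cf cg.
apply: (c_ext (f := fun x => (tree_nat (enc (f x)) - tree_nat (enc (g x))) +
   (tree_nat (enc (g x)) - tree_nat (enc (f x))) == 0)).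
  move=> x; case: (f x =P g x) => [->|ne]; first by rewrite subnn.
  apply/eqP => e; case: ne; apply: encI; apply: tree_nat_inj; lia.
have cn h : computable h -> computable (fun x : G => tree_nat (enc (h x : A))).
  move=> ch; apply: c_bfold; [exact: c_const| |exact: c_enc].
  by c_tac; apply: c_add; [apply: c_mul; apply: c_add|]; c_tac.
apply: (c_app (f := fun n : nat => n == 0)) ; last first.
  by apply: c_add; apply: c_sub; exact: cn.
exists (fun b => if b is Node _ _ then Leaf else Node Leaf Leaf).
  by apply: tc_if; [exact: tc_id|exact: tc_leaf|exact: tc_const].
by case.
Qed.

Ltac c_known ::= lazymatch goal with
  | |- computable (fun x => cat (@?f x) (@?g x)) => apply (c_cat (f := f) (g := g))
  | |- computable (fun x => rcons (@?f x) (@?g x)) => apply (c_rcons (f := f) (g := g))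
  | |- computable (fun x => map (@?f x) (@?l x)) => apply (c_map (f := f) (l := l))
  | |- computable (fun x => filter (@?f x) (@?l x)) => apply (c_filter (f := f) (l := l))
  | |- computable (fun x => all (@?f x) (@?l x)) => apply (c_all (f := f) (l := l))
  | |- computable (fun x => flatten (@?l x)) => apply (c_flatten (l := l))
  | |- computable (fun x => nth (@?z x) (@?l x) (@?n x)) => apply (c_nth (z := z) (l := l) (n := n))
  | |- computable (fun x => iota (@?f x) (@?g x)) => apply (c_iota (f := f) (g := g))
  | |- computable (fun x => size (@?f x)) => apply (c_size (f := f))
  | |- computable (fun x => addn (@?f x) (@?g x)) => apply (c_add (f := f) (g := g))
  | |- computable (fun x => muln (@?f x) (@?g x)) => apply (c_mul (f := f) (g := g))
  | |- computable (fun x => expn (@?f x) (@?g x)) => apply (c_exp (f := f) (g := g))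
  | |- computable (fun x => eq_op (@?f x) (@?g x)) => apply (@c_eq _ _ _ _ _ f g)
  end.

(** * Recursion on codes of terms and programs *)

Section Coded.
Variable F : countType.

#[export] Instance coded_sym : coded F | 100 := fun f => code_nat (pickle f).
#[export] Instance coded_term : coded (term F) := @code_term F.
#[export] Instance coded_label : coded (label F) := @code_label F.
#[export] Instance coded_procedure : coded (procedure F) := @code_procedure F.
#[export] Instance coded_program : coded (program F) := @code_program F.

#[export] Instance enc_inj_term : enc_inj (term F).
Proof.
rewrite /enc_inj /enc /coded_term; elim/term_indS => [x|f ts IH] [y|g us] //= [].
  by move=> /(@enc_inj_nat x y) ->.
move=> /(@enc_inj_nat _ _) /(pcan_inj pickleK) -> e; congr App.
elim: ts us IH e => [|t ts IHts] [|u us] IH //= [e1 e2].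
rewrite (IH t (mem_head _ _) _ e1); congr cons; apply: IHts e2 => s si.
by apply: IH; rewrite inE si orbT.
Qed.

Fixpoint tfold (B : Type) (v : nat -> B) (a : F -> seq (term F) -> seq B -> B) (t : term F) : B :=
  match t with
  | Var x => v x
  | App f ts => a f ts (map (tfold v a) ts)
  end.

Section Closure.
Context {G B : Type} {cG : coded G} {cB : coded B}.

Lemma c_Var (f : G -> nat) : computable f -> computable (fun x => Var F (f x)).
Proof.
case=> g tg eg; exists (fun x => Node Leaf (g x)); first exact: tc_node tc_leaf tg.
by move=> a; rewrite eg.
Qed.

Lemma c_App (f : G -> F) (ts : G -> seq (term F)) : computable f -> computable ts ->
  computable (fun x => App (f x) (ts x)).
Proof.
case=> g tg eg [h th eh]; exists (fun x => Node (Node Leaf Leaf) (Node (g x) (h x))).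
  by apply: tc_node (tc_const _) _; apply: tc_node.
by move=> a; rewrite eg eh.
Qed.

(* The recursion visits all subtrees of a code, so it computes for each of them
   a value as a term and a value as a list of terms. *)
Lemma c_tfold (v : G -> nat -> B) (a : G -> F -> seq (term F) -> seq B -> B) (t : G -> term F) :
  computable (fun x : G * nat => v x.1 x.2) ->
  computable (fun x : G * (F * (seq (term F) * seq B)) => a x.1 x.2.1 x.2.2.1 x.2.2.2) ->
  computable t -> computable (fun x => tfold (v x) (a x) (t x)).
Proof.
case=> v' tv ev [a' ta ea] [t' tt et].
(* [u] is the tag of a term code, [d] its payload and [rd] the result on the payload. Read as a
   list, the payload of an application starts with the symbol; the two [bright] select the list
   value and drop that entry. *)
pose nodeT (p u d rd : btree) := if u is Node _ _
  then a' (Node p (Node (bleft d) (Node (bright d) (bright (bright rd)))))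
  else v' (Node p d).
pose g' y := Node (nodeT (bleft y) (bleft (bleft (bright y))) (bright (bleft (bright y)))
    (bright (bright (bright y))))
  (Node (bleft (bleft (bright (bright y)))) (bright (bright (bright (bright y))))).
exists (fun x => bleft (brec (fun _ => Node Leaf Leaf) g' x (t' x))).
  apply: tc_left; apply: tc_rec tt; [exact: tc_const| |exact: tc_id].
  apply: tc_node; last by do ![apply: tc_node|apply: tc_left|apply: tc_right|apply: tc_id].
  apply: tc_if; first by do ![apply: tc_left|apply: tc_right|apply: tc_id].
    by apply: tc_comp ta _; do ![apply: tc_node|apply: tc_left|apply: tc_right|apply: tc_id].
  by apply: tc_comp tv _; do ![apply: tc_node|apply: tc_left|apply: tc_right|apply: tc_id].
move=> x; rewrite et; set R := brec _ _ _; rewrite -[enc (t x)]/(code_term (t x)).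
elim/term_indS: (t x) => [z|f ts IH]; first exact: (ev (x, z)).
have -> : bleft (R (code_term (App f ts))) =
    a' (Node (enc x) (Node (code_nat (pickle f)) (Node (code_seq (@code_term F) ts)
      (bright (R (code_seq (@code_term F) ts)))))) by [].
suff -> : bright (R (code_seq (@code_term F) ts)) = code_seq cB (map (tfold (v x) (a x)) ts).
  exact: (ea (x, (f, ((ts : seq (term F)), map (tfold (v x) (a x)) ts)))).
elim: ts IH => [_|s ts IHts IH]; first exact: erefl.
have -> : bright (R (code_seq (@code_term F) (s :: ts))) =
  Node (bleft (R (code_term s))) (bright (R (code_seq (@code_term F) ts))) by [].
rewrite IHts => [|u ui]; last by apply: IH; rewrite inE ui orbT.
by rewrite [bleft _](IH s (mem_head _ _)).
Qed.

Lemma c_label (f : G -> nat -> term F -> B) (g h : G -> nat -> B) (l : G -> label F) :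
  computable (fun x : G * (nat * term F) => f x.1 x.2.1 x.2.2) ->
  computable (fun x : G * nat => g x.1 x.2) -> computable (fun x : G * nat => h x.1 x.2) ->
  computable l ->
  computable (fun x => match l x with Assign y t => f x y t | Havoc y => g x y | Call r => h x r end).
Proof.
case=> f' tf ef [g' tg eg] [h' th eh] [l' tl el].
exists (fun x => if bleft (l' x) is Node _ _ then
    if bright (bleft (l' x)) is Node _ _ then h' (Node x (bright (l' x)))
    else g' (Node x (bright (l' x)))
  else f' (Node x (bright (l' x)))).
  apply: tc_if; first exact: tc_left.
    apply: tc_if; first by apply: tc_right; apply: tc_left.
      by apply: tc_comp th _; apply: tc_node tc_id _; apply: tc_right.
    by apply: tc_comp tg _; apply: tc_node tc_id _; apply: tc_right.
  by apply: tc_comp tf _; apply: tc_node tc_id _; apply: tc_right.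
move=> x; rewrite el; case: (l x) => [y t|y|r].
- exact: (ef (x, (y, t))).
- exact: (eg (x, y)).
- exact: (eh (x, r)).
Qed.

Lemma c_proj (T T' : Type) (cT : coded T) (cT' : coded T') (pr : T -> T') g (f : G -> T) :
  (forall a, g (enc a) = enc (pr a)) -> tcomp g -> computable f -> computable (fun x => pr (f x)).
Proof. by move=> e tg; apply: c_app; exists g. Qed.

Lemma c_nvars (f : G -> program F) : computable f -> computable (fun x => nvars (f x)).
Proof. by apply: (c_proj (g := bleft)) => //; apply: tc_left tc_id. Qed.

Lemma c_procs (f : G -> program F) : computable f -> computable (fun x => procs (f x)).
Proof.
by apply: (c_proj (g := fun b => bleft (bright b))) => //; apply: tc_left; apply: tc_right tc_id.
Qed.

Lemma c_main (f : G -> program F) : computable f -> computable (fun x => main (f x)).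
Proof.
by apply: (c_proj (g := fun b => bright (bright b))) => //; apply: tc_right; apply: tc_right tc_id.
Qed.

Lemma c_start (f : G -> procedure F) : computable f -> computable (fun x => start (f x)).
Proof.
by apply: (c_proj (g := fun b => bleft (bright b))) => //; apply: tc_left; apply: tc_right tc_id.
Qed.

Lemma c_ret (f : G -> procedure F) : computable f -> computable (fun x => ret (f x)).
Proof.
apply: (c_proj (g := fun b => bleft (bright (bright b)))) => //.
by apply: tc_left; do 2![apply: tc_right]; apply: tc_id.
Qed.
End Closure.

(* [code_edge] nests the three components of an edge differently from [enc]. *)
Record wedge := Wedge { unwedge : nat * label F * nat }.
#[export] Instance coded_wedge : coded wedge := fun e => code_edge (unwedge e).

Lemma c_edges (G : Type) (cG : coded G) (f : G -> procedure F) :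
  computable f -> computable (fun x => edges (f x)).
Proof.
move=> cf; apply: (c_ext (f := fun x => map unwedge (map Wedge (edges (f x))))).
  by move=> x; rewrite -map_comp map_id.
apply: (c_map (f := fun _ => unwedge)).
  apply: (c_proj (g := fun b => Node (Node (bleft b) (bleft (bright b))) (bright (bright b)))) => //.
    by do ![apply: tc_node|apply: tc_left|apply: tc_right|apply: tc_id].
  exact: c_snd c_id.
apply: (c_proj (pr := fun pr => map Wedge (edges pr)) (g := fun b => bright (bright (bright b)))) cf.
  by case=> a b c es; rewrite /enc /= /coded_seq; elim: es => //= e es ->.
by do 3![apply: tc_right]; apply: tc_id.
Qed.
End Coded.

(** * The algorithm *)

Section Algorithm.
Variable F : countType.

Ltac c_prog := lazymatch goal with
  | |- computable (fun x => nvars (@?f x)) => apply (c_nvars (f := f))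
  | |- computable (fun x => procs (@?f x)) => apply (c_procs (f := f))
  | |- computable (fun x => main (@?f x)) => apply (c_main (f := f))
  | |- computable (fun x => start (@?f x)) => apply (c_start (f := f))
  | |- computable (fun x => ret (@?f x)) => apply (c_ret (f := f))
  | |- computable (fun x => edges (@?f x)) => apply (c_edges (f := f))
  | |- computable (fun x => Var _ (@?f x)) => apply (c_Var _ (f := f))
  | |- computable (fun x => App (@?f x) (@?g x)) => apply (c_App (f := f) (ts := g))
  | |- computable (fun x => tfold (@?v x) (@?a x) (@?t x)) => apply (c_tfold (v := v) (a := a) (t := t))
  | |- computable (fun x => getp (@?f x) (@?q x)) => rewrite /getp
  end.
Ltac c_all_tac := repeat (cbv beta; first [c_prog | c_step]).

Lemma c_subst1 (G : Type) (cG : coded G) (a : G -> letter F) (t : G -> term F) :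
  computable a -> computable t -> computable (fun x => subst1 (a x) (t x)).
Proof.
move=> ca ct.
apply: (c_ext (f := fun x => tfold (fun z => if z == (a x).1 then (a x).2 else Var F z)
  (fun f _ rs => App f rs) (t x))); last by c_all_tac.
move=> x; rewrite /subst1; elim/term_indS: (t x) => [z|f ts IH] //=.
by congr App; apply/eq_in_map => s /IH.
Qed.

Lemma c_wp (G : Type) (cG : coded G) (w : G -> word F) (t : G -> term F) :
  computable w -> computable t -> computable (fun x => wp (w x) (t x)).
Proof.
move=> cw ct; rewrite /wp; apply (c_foldr (f := fun _ => @subst1 F)) => //.
by apply: c_subst1; c_all_tac.
Qed.

Lemma c_alledges (G : Type) (cG : coded G) (p : G -> program F) :
  computable p -> computable (fun x => alledges (p x)).
Proof. by move=> cp; rewrite /alledges; c_all_tac. Qed.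

Lemma c_extend (G : Type) (cG : coded G) (p : G -> program F) (db : G -> seq (item F))
    (qe : G -> nat * (nat * label F * nat)) (it : G -> item F) :
  computable p -> computable db -> computable qe -> computable it ->
  computable (fun x => extend (p x) (db x) (qe x) (it x)).
Proof.
move=> cp cdb cqe cit; rewrite /extend; apply: c_if; [by c_all_tac| |exact: c_const].
apply: c_label; [by c_all_tac|by c_all_tac|by c_all_tac|by c_all_tac].
Qed.

Lemma c_db (G : Type) (cG : coded G) (p : G -> program F) (k : G -> nat) :
  computable p -> computable k -> computable (fun x => db (p x) (k x)).
Proof.
move=> cp ck; rewrite /db; apply (c_iter (f := fun x => step (p x))) => //.
  rewrite /step; apply: c_cat; first by c_all_tac.
  apply: c_flatten.
  apply (c_map (f := fun x qe => flatten [seq extend (p x.1) x.2 qe it | it <- x.2])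
    (l := fun x => alledges (p x.1))).
    apply: c_flatten.
    apply (c_map (f := fun x it => extend (p x.1.1) x.1.2 x.2 it) (l := fun x => x.1.2)).
      by apply: c_extend; c_all_tac.
    by c_all_tac.
  by apply: c_alledges; c_all_tac.
by rewrite /db0; c_all_tac.
Qed.

Lemma c_rounds (G : Type) (cG : coded G) (b : G -> btree) :
  computable b -> computable (fun x => rounds (b x)).
Proof.
move=> cb; apply: (c_ext (f := fun x =>
  let S := 4 * (bfold 1 (fun m n => (m + n).+1) (b x)).+1 in S ^ (S * S))).
  move=> x; rewrite /rounds (_ : tree_size (b x) = bfold 1 (fun m n => (m + n).+1) (b x)) //.
  by elim: (b x) => //= a -> c ->.
by rewrite /=; c_all_tac.
Qed.

(* The program input is paired with an equality only to obtain a bound on the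
   number of rounds that depends on both. *)
Definition reaching (p : program F) (u : point) (e : equality F) : seq (item F) :=
  [seq it <- db p (rounds (enc (p, e))) | it.1 == (true, u)].

Lemma c_reaching (G : Type) (cG : coded G) (p : G -> program F) (u : G -> point)
    (e : G -> equality F) :
  computable p -> computable u -> computable e -> computable (fun x => reaching (p x) (u x) (e x)).
Proof.
move=> cp cu ce; rewrite /reaching; apply: c_filter; first by c_all_tac.
by apply: c_db => //; apply: c_rounds; apply: c_enc; apply: c_pair.
Qed.

Definition decide (p : program F) (u : point) (e : equality F) : bool :=
  all (fun it : item F => wp it.2 e.1 == wp it.2 e.2) (reaching p u e).

Lemma c_decide (G : Type) (cG : coded G) (p : G -> program F) (u : G -> point)
    (e : G -> equality F) :
  computable p -> computable u -> computable e -> computable (fun x => decide (p x) (u x) (e x)).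
Proof.
move=> cp cu ce; rewrite /decide; apply: c_all; last exact: c_reaching.
by apply: c_eq; apply: c_wp; c_all_tac.
Qed.

Definition choices (T : Type) (ls : seq (seq T)) : seq (seq T) :=
  foldr (fun l acc => flatten [seq [seq x :: r | r <- acc] | x <- l]) [:: [::]] ls.

(* The terms [t'] over the variable [y] with [t'[a/y] = t]. *)
Definition antis (y : nat) (a t : term F) : seq (term F) :=
  tfold (fun z => if Var F z == a then [:: Var F y] else [::])
    (fun f ts rs => (if App f ts == a then [:: Var F y] else [::]) ++ [seq App f us | us <- choices rs]) t.

Lemma c_antis (G : Type) (cG : coded G) (y : G -> nat) (a t : G -> term F) :
  computable y -> computable a -> computable t -> computable (fun x => antis (y x) (a x) (t x)).
Proof. by move=> cy ca ct; rewrite /antis; c_all_tac; rewrite /choices; c_all_tac. Qed.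

Definition candidates (n : nat) (w : word F) : seq (equality F) :=
  flatten [seq flatten [seq [seq (Var F x, t) | t <- antis y (wp w (Var F y)) (wp w (Var F x))]
    | y <- iota 0 n] | x <- iota 0 n].

(** At an unreachable point everything is valid, and [v], an equality between different values,
    entails everything. At a reachable point a valid equality of a variable with a term holds after
    the first word found, hence is among the finitely many candidates of that word. The equality of
    [Var F 0] with itself merely fills the argument from which the number of rounds is computed. *)
Definition basis (v : equality F) (p : program F) (u : point) : seq (equality F) :=
  if reaching p u (Var F 0, Var F 0) is it :: _
  then [seq e <- candidates (nvars p) it.2 | decide p u e] else [:: v].

Lemma c_candidates (G : Type) (cG : coded G) (n : G -> nat) (w : G -> word F) :
  computable n -> computable w -> computable (fun x => candidates (n x) (w x)).
Proof.
move=> cn cw; rewrite /candidates; c_all_tac.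
by apply: c_antis; [|apply: c_wp|apply: c_wp]; c_all_tac.
Qed.

Lemma c_basis v (G : Type) (cG : coded G) (p : G -> program F) (u : G -> point) :
  computable p -> computable u -> computable (fun x => basis v (p x) (u x)).
Proof.
move=> cp cu; rewrite /basis; apply: c_lcase; first exact: c_const.
  apply: c_filter; first by apply: c_decide; c_all_tac.
  by apply: c_candidates; c_all_tac.
by apply: c_reaching => //; exact: c_const.
Qed.
End Algorithm.

(** * Correctness *)

Section Antis.
Variables (F : countType) (ar : F -> nat).
Implicit Types (s t a b : term F).

Lemma choicesP (us : seq (term F)) ls : (us \in choices ls) = all2 (fun u l => u \in l) us ls.
Proof.
elim: ls us => [|l ls IH] us; first by case: us.
apply/flatten_mapP/idP => [[x xl /mapP[r]]|].
  by rewrite IH => h -> /=; rewrite xl.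
case: us => //= u us /andP[ul]; rewrite -IH => h; exists u => //.
by apply/mapP; exists us.
Qed.

Lemma antis_App y a f ts : antis y a (App f ts) =
  (if App f ts == a then [:: Var F y] else [::]) ++
  [seq App f us | us <- choices [seq antis y a t | t <- ts]].
Proof. by []. Qed.

Lemma antis_sound y a b t : t \in antis y a b -> {subset vars t <= [:: y]} /\ (ranked ar b -> ranked ar t).
Proof.
elim/term_indS: b t => [z|f ts IH] t.
  by rewrite /antis /=; case: ifP => // _; rewrite inE => /eqP->; split=> // x.
rewrite antis_App mem_cat => /orP[|/mapP[us]].
  by case: ifP => // _; rewrite inE => /eqP->; split=> // x.
rewrite choicesP => h ->; suff : {subset vars (App f us) <= [:: y]} /\
    (all (ranked ar) ts -> (size us = size ts) * all (ranked ar) us).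
  case=> h1 h2; split=> //= /andP[/eqP <-] /h2[-> ->]; by rewrite eqxx.
elim: ts us IH h => [|s ts IHts] [|u us] //= IH /andP[us1 us2].
have [s1 s2] := IH s (mem_head _ _) u us1.
have [|r1 r2] := IHts us _ us2; first by move=> r ri; apply: IH; rewrite inE ri orbT.
split=> [z|/andP[/s2-> /r2[-> ->]]] //.
by rewrite /= mem_cat => /orP[/s1|/r1].
Qed.

Lemma antis_complete y a b t : {subset vars t <= [:: y]} -> plug t a = b -> t \in antis y a b.
Proof.
elim/term_indS: t b => [z|f ts IH] b st /= <-.
  have -> : z = y by have := st z; rewrite !inE eqxx => /(_ isT)/eqP.
  by rewrite /plug /=; case: a => [x|g us]; rewrite /antis /= ?mem_cat eqxx inE eqxx.
rewrite [plug _ _]/= antis_App mem_cat; apply/orP; right; apply/mapP; exists ts => //.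
rewrite choicesP -map_comp; elim: ts IH st => //= t ts IHts IH st.
rewrite IH ?mem_head //; last by move=> z zi; apply: st; rewrite /= mem_cat zi.
apply: IHts => [r ri|z zi]; first by apply: IH; rewrite inE ri orbT.
by apply: st; rewrite /= mem_cat; apply/orP; right.
Qed.
End Antis.

Section Correct.
Variables (F : countType) (ar : F -> nat) (p : program F).
Hypotheses (wfp : wf_program ar p) (initp : init_restricted p).
Variables (v1 v2 : term F).
Hypotheses (vv1 : value ar v1) (vv2 : value ar v2) (v12 : v1 <> v2).
Let n := nvars p.

Lemma in_reaching u e it : it \in reaching p u e -> derives p two true u it.2.
Proof.
rewrite mem_filter => /andP[/eqP ei h]; apply/(derives_db wfp).
by eexists; rewrite -ei -surjective_pairing; exact: h.
Qed.

Lemma bound_program e : tree_size (code_program p) <= tree_size (enc (p, e : equality F)).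
Proof. by rewrite /=; lia. Qed.

Lemma bound_nvars e : nvars p <= tree_size (enc (p, e : equality F)).
Proof. by have := tree_size_nat (nvars p); rewrite /=; lia. Qed.

Lemma bound_term (e : equality F) :
  tdepth e.1 <= tree_size (enc (p, e)) /\ tdepth e.2 <= tree_size (enc (p, e)).
Proof.
have := tree_size_term e.1; have := tree_size_term e.2; rewrite /= /enc /coded_term; lia.
Qed.

Lemma reaching_nil u e : reaching p u e = [::] -> forall w, ~ derives p two true u w.
Proof.
move=> r0 w /(derives_db wfp)[k wd].
have [N1 _] := rounds_enough wfp (bound_program e) erefl (bound_nvars e).
suff : ((true, u), w) \notin db p k by rewrite wd.
apply: (empty_bound wfp initp N1) => w'; apply/negP => wd'.
have : ((true, u), w') \in reaching p u e by rewrite mem_filter eqxx.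
by rewrite r0.
Qed.

Lemma decide_valid u e : two_var_equality ar n e -> (valid_at ar p u e <-> decide p u e).
Proof.
move=> te; have := te => /and4P[/andP[_ s1] a1 /andP[_ s2] a2].
apply: (iff_trans (valid_iff wfp u vv1 vv2 v12 te)); split.
  by move=> V; apply/allP => it /in_reaching/V ->.
move=> /allP D w /(derives_db wfp)[k wd].
(* Here [H] is the square of the input size, which bounds both the depth of the two sides and the
   depth of every letter. *)
have [N1 N2] := rounds_enough wfp (bound_program e) erefl (bound_nvars e).
have [d1 d2] := bound_term e.
have hM := plets_depth wfp (bound_program e).
apply: (eq_bound wfp initp N1 N2 hM _ _ s1 s2 a1 a2) wd; try by rewrite leq_mul2r ?d1 ?d2 orbT.
move=> w' wd'; apply/eqP; apply: (D ((true, u), w')).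
by rewrite mem_filter eqxx.
Qed.

Lemma derives_ranked H b u w : derives p H b u w -> all (fun a : letter F => ranked ar a.2) w.
Proof.
elim=> //= {b u w} [b q u w x t v _ IH /(wf_edge wfp)[_ _ /and3P[_ /andP[rt _] _] _ _]|
  b q u w x k v _ IH _ _|b q u w r pr v w2 _ IH _ _ _ IH2].
- by rewrite all_rcons IH andbT.
- by rewrite all_rcons IH andbT.
- by rewrite all_cat IH.
Qed.

Lemma ranked_wp w t : all (fun a : letter F => ranked ar a.2) w -> ranked ar t -> ranked ar (wp w t).
Proof.
elim: w => //= a w IH /andP[ra rw] rt; apply: ranked_subst; first exact: IH.
by move=> z _; rewrite /upd; case: eqP.
Qed.

Lemma wp_subst w t : wp w t = subst (fun z => wp w (Var F z)) t.
Proof.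
elim/term_indS: t => // f ts IH; rewrite wp_App /=; congr App.
by apply/eq_in_map => t /IH.
Qed.

Lemma candidates_two_var w e : all (fun a : letter F => ranked ar a.2) w ->
  e \in candidates n w -> two_var_equality ar n e.
Proof.
move=> rw /flatten_mapP[x xn /flatten_mapP[y yn /mapP[t /(antis_sound ar)[st rt] ->]]].
move: xn yn; rewrite !mem_iota !add0n /= => xn yn.
apply/and4P; split=> //=.
- by rewrite /wf_term /= xn.
- by rewrite /wf_term rt ?ranked_wp //; apply/allP => z /st; rewrite inE => /eqP->.
- by apply/at_most_one_varP; exists y.
Qed.

Lemma candidates_complete w x t : x < n -> wf_term ar n t -> at_most_one_var t ->
  wp w (Var F x) = wp w t -> (Var F x, t) \in candidates n w.
Proof.
move=> xn /andP[_ /allP vt] /at_most_one_varP[y0 st] e.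
have [y yn sy] : exists2 y, y < n & {subset vars t <= [:: y]}.
  have [g|/groundPn[z zi]] := boolP (ground t).
    (* A ground term is found with any variable; [x] is at hand as one below [n]. *)
    by exists x => // z; move/groundP: g => /(_ z)/negPf->.
  by exists y0 => //; apply: vt; have := st _ zi; rewrite inE => /eqP<-.
apply/flatten_mapP; exists x; first by rewrite mem_iota.
apply/flatten_mapP; exists y; first by rewrite mem_iota.
apply/mapP; exists t => //; apply: antis_complete => //.
by rewrite e [RHS]wp_subst; apply/esym; apply: subst1v sy _.
Qed.

(** A valid equality with a variable on its left is itself in the basis, up to symmetry this covers
    a variable on either side, and all others decompose into such equalities. The word of [it] shows
    that head symbols and numbers of arguments agree. *)
Lemma basis_entails u it (s t : term F) : it \in reaching p u (Var F 0, Var F 0) ->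
  two_var_equality ar n (s, t) ->
  (forall w, derives p two true u w -> wp w s = wp w t) ->
  entails ar n [seq e <- candidates n it.2 | decide p u e] (s, t).
Proof.
move=> /in_reaching D + V r rs rE.
have leaf x t' : two_var_equality ar n (Var F x, t') ->
    (forall w, derives p two true u w -> wp w (Var F x) = wp w t') -> holds r (Var F x, t').
  move=> te V'; apply: rE; apply/InP; rewrite mem_filter.
  have := te => /and4P[/= /andP[_ /= ]]; rewrite andbT => xn _ wt at_.
  rewrite candidates_complete ?V' // andbT; apply/decide_valid => //.
  exact/(valid_iff wfp u vv1 vv2 v12 te).
have arg f (ts : seq (term F)) t' : t' \in ts -> wf_term ar n (App f ts) -> at_most_one_var (App f ts) ->
    wf_term ar n t' /\ at_most_one_var t'.
  move=> ti /andP[rt /allP vt] /at_most_one_varP[x sx]; split.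
    move: rt => /= /andP[_ /allP rt]; apply/andP; split; first exact: rt.
    by apply/allP => z zi; apply: vt; apply: in_vars_App ti zi.
  by apply/at_most_one_varP; exists x => z zi; apply: sx; apply: in_vars_App ti zi.
rewrite /holds /=; elim/term_indS: s t V => [x|f ss IH] t V te; first exact: leaf te V.
case: t V te => [y|g ts] V te.
  apply/esym; apply: (leaf y); last by move=> w /V.
  by case/and4P: te => *; apply/and4P.
move/and4P: te => /= [wf1 am1 wf2 am2].
have V' w : derives p two true u w -> f = g /\ map (wp w) ss = map (wp w) ts.
  by move=> /V; rewrite !wp_App => -[].
have [<- _] := V' _ D; congr App.
have {V' V}V w : derives p two true u w -> map (wp w) ss = map (wp w) ts by case/V'.
have argS a ai := arg f ss a ai wf1 am1; have argT a ai := arg g ts a ai wf2 am2.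
clear wf1 am1 wf2 am2.
elim: ss ts IH V argS argT => [|s ss IHs] [|t ts] IH V argS argT //; try by have := V _ D.
have [s1 s2] := argS s (mem_head _ _); have [t1 t2] := argT t (mem_head _ _).
rewrite /=; congr cons.
  apply: (IH s (mem_head _ _) t); last by apply/and4P.
  by move=> w /V [].
apply: IHs => [a ai|w /V[_ ->//]|a ai|a ai].
- by apply: IH; rewrite inE ai orbT.
- by apply: argS; rewrite inE ai orbT.
- by apply: argT; rewrite inE ai orbT.
Qed.

Lemma basis_correct u : is_basis ar p u (basis (v1, v2) p u).
Proof.
have wfv v : value ar v -> wf_term ar n v && at_most_one_var v.
  by move=> /andP[rv]; rewrite /wf_term /at_most_one_var rv /ground; case: (vars v).
rewrite /basis; case er: (reaching _ _ _) => [|it l].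
  split; first by rewrite /= andbT /two_var_equality andbA !wfv.
  move=> e te; split=> [_ r _|_].
    move=> /(_ (v1, v2) (or_introl erefl)) h; case: v12; move: h.
    by have /andP[_ g1] := vv1; have /andP[_ g2] := vv2; rewrite /holds /= !subst_ground.
  by apply/(valid_iff wfp u vv1 vv2 v12 te) => w /(reaching_nil er).
have ir : it \in reaching p u (Var F 0, Var F 0) by rewrite er mem_head.
have tE : {in [seq e <- candidates n it.2 | decide p u e], forall e, two_var_equality ar n e}.
  move=> e; rewrite mem_filter => /andP[_]; apply: candidates_two_var.
  exact: derives_ranked (in_reaching ir).
split; first exact/allP.
move=> [s t] te; split.
  by move/(valid_iff wfp u vv1 vv2 v12 te) => V; exact: basis_entails ir te V.
move=> E st r R; apply: (E r (reaches_is_state wfp R)) => e /InP ei;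
have := ei; rewrite mem_filter => /andP[+ _].
by move=> /(decide_valid u (tE _ ei)); apply; exact: R.
Qed.
End Correct.

Theorem theorem5 (F : countType) (ar : F -> nat)
    (hconst : exists c : F, ar c = 0) :
  exists basis decide : recfun,
    forall p : program F, wf_program ar p -> init_restricted p ->
    forall u : point, is_point p u ->
      computes_basis ar basis p u /\ decides_validity ar decide p u.
Proof.
(* The case distinction concerns the signature alone, so the two algorithms may depend on it.
   Without two different values every equality holds in every state. *)
have [[v1 [v2 [vv1 vv2 v12]]]|one] :=
  classic (exists v1 v2 : term F, [/\ value ar v1, value ar v2 & v1 <> v2]).
  have [rb hb] : exists r, forall x : program F * point,
      computes r (enc x) (enc (basis (v1, v2) x.1 x.2)).
    by apply: computable_recfun; apply: c_basis; [exact: c_fst c_id|exact: c_snd c_id].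
  have [rd hd] : exists r, forall x : program F * (point * equality F),
      computes r (enc x) (enc (decide x.1 x.2.1 x.2.2)).
    apply: computable_recfun; apply: c_decide; first exact: c_fst c_id.
      exact: c_fst (c_snd c_id).
    exact: c_snd (c_snd c_id).
  exists rb, rd => p wfp initp u _; split.
    exists (basis (v1, v2) p u); first exact: (hb (p, u)).
    exact: (basis_correct wfp initp vv1 vv2 v12 u).
  move=> e te; exists (decide p u e); first exact: (hd (p, (u, e))).
  exact: (decide_valid wfp initp vv1 vv2 v12 u te).
have same (v1 v2 : term F) : value ar v1 -> value ar v2 -> v1 = v2.
  by move=> h1 h2; apply: NNPP => ne; apply: one; exists v1, v2.
have all_hold n r e : two_var_equality ar n e -> is_state ar n r -> holds r e.
  by move=> /and4P[w1 _ w2 _] rs; apply: same; apply: value_subst rs.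
(* [Leaf] is the code of the empty basis, and [Node Leaf Leaf] is the code of [true]. *)
exists RLeaf, (RPair RLeaf RLeaf) => p wfp initp u _; split.
  exists [::]; first exact: computes_leaf.
  split=> // e te; split=> [_ r rs _|_ st r R]; first exact: all_hold te rs.
  exact: all_hold te (reaches_is_state wfp R).
move=> e te; exists true; first by apply: computes_pair; exact: computes_leaf.
by split=> // _ st r R; apply: all_hold te (reaches_is_state wfp R).
Qed.
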